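(* Painter wins the online Ramsey game for $C_3$ on the class of $K_4$-minor-free graphs.
   Context: All graphs are finite and simple (except that the game board has an unbounded supply of vertices, with only finitely many edges at each moment). A graph is $K_4$-minor-free if it does not contain the complete graph $K_4$ as a minor. Online Ramsey game for $H$ on $\mathcal{C}$, where $\mathcal{C}$ is a class of graphs and $H$ is a fixed graph: the initial state is an unbounded (infinite) set of vertices with no edges. On each turn Builder introduces a new edge between two vertices, with the constraint that the resulting graph must be in $\mathcal{C}$, and then Painter colors the new edge either red or blue (permanently). Builder wins the game if he has a strategy that forces Painter to make a monochromatic copy of $H$ at some point (after finitely many turns). Otherwise, i.e. if Painter can avoid creating a monochromatic copy of $H$ forever, Painter wins. $C_3$ is the triangle. *)

(* Defs.v *)
From Stdlib Require Import Classical ClassicalEpsilon.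
From mathcomp Require Import all_boot.
Set Implicit Arguments.
Unset Strict Implicit.
Unset Printing Implicit Defensive.

(* Simple graphs.  The vertex type may be infinite, because the game board
   has infinitely many vertices. *)
Record sgraph := SGraph {
  vertex :> eqType;
  adj : rel vertex;
  adj_sym : symmetric adj;
  adj_irrefl : irreflexive adj }.

Lemma complete_sym n : symmetric (fun i j : 'I_n => i != j).
Proof. by move=> i j; rewrite eq_sym. Qed.

Lemma complete_irrefl n : irreflexive (fun i j : 'I_n => i != j).
Proof. by move=> i; rewrite eqxx. Qed.

Definition complete_graph (n : nat) : sgraph :=
  SGraph (@complete_sym n) (@complete_irrefl n).

Definition K4 : sgraph := complete_graph 4.

Definition C3 : sgraph := complete_graph 3.

(* Subgraphs, not necessarily induced. *)
Definition has_copy (H G : sgraph) : Prop :=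
  exists f : H -> G, injective f /\ (forall u v, adj u v -> adj (f u) (f v)).

Definition connected_in (G : sgraph) (S : pred G) : Prop :=
  forall x y : G, S x -> S y ->
    exists p : seq G, [/\ path (@adj G) x p, last x p = y & all S (x :: p)].

(* [B u] is the branch set of [u], i.e. the set of vertices of [G] that is
   contracted to [u]. *)
Definition is_minor (H G : sgraph) : Prop :=
  exists B : H -> pred G,
    [/\ forall u, exists x, B u x,
        forall u, connected_in (B u),
        forall u v x, B u x -> B v x -> u = v
      & forall u v, adj u v -> exists x y, [/\ B u x, B v y & adj x y]].

Definition K4_minor_free (G : sgraph) : Prop := ~ is_minor K4 G.

Section EdgeGraph.
Variable E : seq (nat * nat).

Definition edge_rel : rel nat :=
  fun x y => (x != y) && (((x, y) \in E) || ((y, x) \in E)).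

Lemma edge_rel_sym : symmetric edge_rel.
Proof. by move=> x y; rewrite /edge_rel eq_sym orbC. Qed.

Lemma edge_rel_irrefl : irreflexive edge_rel.
Proof. by move=> x; rewrite /edge_rel eqxx. Qed.

Definition edge_graph : sgraph := SGraph edge_rel_sym edge_rel_irrefl.
End EdgeGraph.

(* A position records the coloured edges in the order of play, the latest one
   first, so it is also the full history of the game.  The colour [true] is
   red and [false] is blue. *)
Definition position := seq ((nat * nat) * bool).

Definition board (s : position) : sgraph := edge_graph [seq m.1 | m <- s].

Definition color_class (c : bool) (s : position) : sgraph :=
  edge_graph [seq m.1 | m <- s & m.2 == c].

Definition mono_copy (H : sgraph) (s : position) : Prop :=
  exists c : bool, has_copy H (color_class c s).

Definition legal (C : sgraph -> Prop) (s : position) (e : nat * nat) : Prop :=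
  [/\ e.1 != e.2,
      ~~ edge_rel [seq m.1 | m <- s] e.1 e.2
    & C (edge_graph (e :: [seq m.1 | m <- s]))].

(* Positions reachable from the empty board when Builder moves arbitrarily and
   Painter follows [sigma]. *)
Inductive reachable (C : sgraph -> Prop) (sigma : position -> nat * nat -> bool)
  : position -> Prop :=
| reachable_nil : reachable C sigma [::]
| reachable_cons s e :
    reachable C sigma s -> legal C s e ->
    reachable C sigma ((e, sigma s e) :: s).

Definition painter_wins (H : sgraph) (C : sgraph -> Prop) : Prop :=
  exists sigma : position -> nat * nat -> bool,
    forall s, reachable C sigma s -> ~ mono_copy H s.

(* The position after [n] turns when Builder follows [tau] and Painter's
   successive colours are [c 0], [c 1], ... *)
Fixpoint play (tau : position -> nat * nat) (c : nat -> bool) (n : nat)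
  : position :=
  if n is n'.+1 then
    let s := play tau c n' in (tau s, c n') :: s
  else [::].

Definition builder_wins (H : sgraph) (C : sgraph -> Prop) : Prop :=
  exists tau : position -> nat * nat, forall c : nat -> bool,
    exists n, (forall k, k < n -> legal C (play tau c k) (tau (play tau c k)))
              /\ mono_copy H (play tau c n).

(* Determinacy: the two ways of saying that Painter wins (Builder has no
   winning strategy; Painter can avoid a monochromatic copy forever) agree. *)
Section Determinacy.
Variables (H : sgraph) (C : sgraph -> Prop).

Fixpoint builder_wins_in (k : nat) (s : position) : Prop :=
  mono_copy H s \/
  if k is k'.+1 then
    exists e, legal C s e /\ forall c, builder_wins_in k' ((e, c) :: s)
  else False.

Lemma builder_wins_in_mono s : mono_copy H s -> forall k, builder_wins_in k s.
Proof. by move=> hs [|k]; left. Qed.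

Lemma builder_wins_in_leq k l s :
  k <= l -> builder_wins_in k s -> builder_wins_in l s.
Proof.
elim: k l s => [|k IH] [|l] s //= lekl; try by case=> // ?; left.
case=> [hs|[e [le he]]]; first by left.
by right; exists e; split=> // c; apply: IH (he c).
Qed.

Lemma size_play tau c n : size (play tau c n) = n.
Proof. by elim: n => //= n ->. Qed.

Lemma builder_wins_in_wins k : builder_wins_in k [::] -> builder_wins H C.
Proof.
move=> wk.
pose good s e := legal C s e /\
  forall c, builder_wins_in (k - (size s).+1) ((e, c) :: s).
pose tau s := epsilon (inhabits (0, 0)) (good s).
exists tau => c; apply: NNPP => nowin.
have inv n : n <= k ->
    (forall i, i < n -> legal C (play tau c i) (tau (play tau c i))) /\
    builder_wins_in (k - n) (play tau c n).
  elim: n => [|n IH] lenk; first by rewrite subn0.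
  have [leg wn] := IH (ltnW lenk).
  have : exists e, good (play tau c n) e.
    move: wn; rewrite -(subnSK lenk) /= => -[hs|[e [le he]]].
      by case: nowin; exists n.
    by exists e; split=> //; rewrite size_play.
  move=> /(epsilon_spec (inhabits (0, 0))) [lt wt]; split.
    by move=> i; rewrite ltnS leq_eqVlt => /orP[/eqP->|/leg].
  by move: (wt (c n)); rewrite size_play.
have [leg] := inv k (leqnn k).
by rewrite subnn => -[hs|//]; apply: nowin; exists k.
Qed.

Lemma painter_wins_iff : painter_wins H C <-> ~ builder_wins H C.
Proof.
split=> [[sigma win] [tau bwin]|nob].
  pose fix q n := if n is n'.+1 then
    (tau (q n'), sigma (q n') (tau (q n'))) :: q n' else [::].
  have [n [leg hn]] := bwin (fun n => sigma (q n) (tau (q n))).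
  set c := (fun _ => _) in leg hn.
  have qE m : play tau c m = q m by elim: m => //= m ->.
  apply: win hn; rewrite qE.
  have {}leg k : k < n -> legal C (q k) (tau (q k)).
    by move=> /leg; rewrite qE.
  elim: n leg => [|n IH] leg; first exact: reachable_nil.
  by apply: reachable_cons; [apply: IH => k kn; apply/leg/ltnW | apply: leg].
pose safe s := forall k, ~ builder_wins_in k s.
pose sigma s e := epsilon (inhabits true) (fun c => safe ((e, c) :: s)).
exists sigma => s rs.
suff sf : safe s by move=> /builder_wins_in_mono /(_ 0); apply: sf.
elim: rs => [|{}s e _ sf le]; first by move=> k /builder_wins_in_wins.
apply: (epsilon_spec (inhabits true) (fun c => safe ((e, c) :: s))).
apply: NNPP => nsafe.
have w c : exists k, builder_wins_in k ((e, c) :: s).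
  by apply: NNPP => nk; apply: nsafe; exists c => k wk; apply: nk; exists k.
have [[k1 w1] [k2 w2]] := (w true, w false).
apply: (sf (maxn k1 k2).+1); right; exists e; split=> // -[].
  by apply: builder_wins_in_leq w1; apply: leq_maxl.
by apply: builder_wins_in_leq w2; apply: leq_maxr.
Qed.
End Determinacy.

(* Main.v *)
From Stdlib Require Import Classical ClassicalEpsilon.
From mathcomp Require Import all_boot zify.
Require Import Defs.
Set Implicit Arguments.
Unset Strict Implicit.
Unset Printing Implicit Defensive.

(** Painter reads red as 1 and blue as 2 and works modulo 3.  The three edges of
a monochromatic triangle have weight 0, so it suffices to keep the weight of
every induced cycle nonzero.  If a new edge splits an induced cycle into two
paths of weights [s] and [t], then a colour [c] is needed with [s + c] and
[t + c] nonzero; both colours fail only when [s] and [t] are 1 and 2 in some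
order, and then the cycle had weight [s + t = 0] already.

The difficulty is that two vertices may be joined by many induced paths, and
two of these need not form an induced cycle.  The remedy is to colour some
edges before Builder draws them.  Call [a] and [b] the poles of a theta when
three disjoint connected sets are each adjacent to both.  The edge [a b] then
creates no K4 minor, now or at any later time ([theta_add_edge]), so Painter may
pretend that it has been drawn.  Painter thus maintains a coloured supergraph
[E] of the board in which every induced cycle has nonzero weight and which is
as permissive as the board: whatever edges are still to come, they create a K4
minor in [E] only if they create one in the board ([extends]).

It remains to add to [E] a new edge [x y] that creates no K4 minor
([extension]).  If both colours fail, there are induced paths [q1] and [q2] from
[x] to [y] whose weights sum to 0.  If they are internally disjoint, an edge
between their interiors would make a K4 minor with [x y] ([chord_K4_minor]), so
they form an induced cycle of weight 0, which is absurd.  Otherwise consider the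
places where two induced paths from [x] to [y] part and meet again.  There they
form a theta with nonadjacent poles [a] and [b], whose third set is made of the
remaining parts of one path, joined by the edge [x y] or by a third path from
[x] to [y] ([detour]).  A theta of [E] itself allows [a b] to be coloured at
once ([theta_colour]): of its three sets, two are far from both obstructing
paths, and these two would give an induced cycle of weight 0.  If the theta uses
[x y], then [a b] is added by recursion before [x y]; this is well founded
because [a] and [b] can be taken on a fixed induced path from [x] to [y], where
they are closer than [x] and [y].  Each preliminary edge decreases the number of
nonadjacent pairs, so the process stops. *)

(** * Connected sets *)

Section Connectivity.
Variable V : eqType.
Implicit Types (E : rel V) (A B S Z : pred V) (a b u v x y : V).

Definition reach E S x y : Prop :=
  exists p, [/\ path E x p, last x p = y & all S (x :: p)].

Definition conn E S : Prop := forall x y, S x -> S y -> reach E S x y.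

Definition adjoining E A B : Prop := exists x y, [/\ A x, B y & E x y].

Lemma reach_refl E S x : S x -> reach E S x x.
Proof. by move=> Sx; exists [::]; rewrite /= Sx. Qed.

Lemma reach_trans E S x y z : reach E S x y -> reach E S y z -> reach E S x z.
Proof.
case=> p [pp lp ap] [q [pq lq aq]]; exists (p ++ q).
rewrite cat_path pp lp pq last_cat lp lq; split=> //.
by rewrite -cat_cons all_cat ap; case/andP: aq.
Qed.

Lemma reach_edge E S x y : S x -> S y -> E x y -> reach E S x y.
Proof. by move=> Sx Sy Exy; exists [:: y]; rewrite /= Exy Sx Sy. Qed.

(** The workhorse for changing both the graph and the allowed vertices: an edge of
the old walk may be replaced by any walk of the new graph. *)
Lemma reach_lift E S E' S' x y : (forall u, S u -> S' u) ->
  (forall u v, S u -> S v -> E u v -> reach E' S' u v) ->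
  reach E S x y -> reach E' S' x y.
Proof.
move=> sS step [p [pp <- ap]].
elim: p x pp ap => [|z p IH] x /=.
  by move=> _ /andP[/sS Sx _]; apply: reach_refl.
case/andP=> Exz pz /and3P[Sx Sz ap].
by apply: reach_trans (step _ _ Sx Sz Exz) _; apply: IH => //=; rewrite Sz.
Qed.

Lemma reach_sub E S E' S' x y : (forall u, S u -> S' u) ->
  (forall u v, S u -> S v -> E u v -> E' u v) ->
  reach E S x y -> reach E' S' x y.
Proof.
move=> sS sE; apply: reach_lift => // u v Su Sv Euv.
by apply: reach_edge; [apply: sS | apply: sS | apply: sE].
Qed.

Lemma reach_sym E S x y : symmetric E -> reach E S x y -> reach E S y x.
Proof.
move=> symE [p [pp <- ap]].
elim: p x pp ap => [|z p IH] x /=.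
  by move=> _ /andP[Sx _]; apply: reach_refl.
case/andP=> Exz pz /and3P[Sx Sz ap].
apply: (@reach_trans _ _ _ z); first by apply: IH => //=; rewrite Sz.
by apply: reach_edge; rewrite // symE.
Qed.

Lemma conn1 E u : conn E (pred1 u).
Proof. by move=> x y /eqP-> /eqP->; apply: reach_refl => /=. Qed.

Lemma connU E A B : symmetric E -> conn E A -> conn E B ->
  (exists u v, [/\ A u, B v & u = v \/ E u v]) -> conn E (predU A B).
Proof.
move=> symE cA cB [u [v [Au Bv uv]]].
have sA z : A z -> predU A B z by move=> /= ->.
have sB z : B z -> predU A B z by move=> /= ->; rewrite orbT.
have rA x y : A x -> A y -> reach E (predU A B) x y.
  by move=> Ax Ay; apply: reach_sub (cA _ _ Ax Ay).
have rB x y : B x -> B y -> reach E (predU A B) x y.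
  by move=> Bx By; apply: reach_sub (cB _ _ Bx By).
have ruv : reach E (predU A B) u v.
  case: uv => [<-|Euv]; first by apply: reach_refl; apply: sA.
  by apply: reach_edge => //; [apply: sA | apply: sB].
have rAB x y : A x -> B y -> reach E (predU A B) x y.
  by move=> Ax By; apply: reach_trans (rA _ _ Ax Au) (reach_trans ruv (rB _ _ Bv By)).
move=> x y /orP[Ax|Bx] /orP[Ay|By]; [exact: rA | exact: rAB | | exact: rB].
by apply: reach_sym => //; apply: rAB.
Qed.

Lemma conn_ext E A B : A =1 B -> conn E A -> conn E B.
Proof.
move=> eAB cA x y; rewrite -!eAB => Ax Ay.
by apply: reach_sub (cA _ _ Ax Ay) => // u; rewrite eAB.
Qed.

Lemma conn_seq E (s : seq V) : symmetric E -> sorted E s -> conn E (mem s).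
Proof.
move=> symE; elim: s => [|x [|y s] IH] /=.
- by move=> _ x y; rewrite inE.
- by move=> _; apply: conn_ext (@conn1 E x) => z /=; rewrite inE.
case/andP=> Exy ps.
apply: (@conn_ext _ (predU (pred1 x) (mem (y :: s)))).
  by move=> z /=; rewrite in_cons.
apply: connU => //; [exact: conn1 | exact: IH |].
by exists x, y; split=> //=; rewrite ?inE ?eqxx //; right.
Qed.

Definition disjoint_family (I : Type) (B : I -> pred V) : Prop :=
  forall i j x, B i x -> B j x -> i = j.

(** Enlarging one member of a family of branch sets along a walk makes it adjacent
to the first other member that the walk meets, since the vertices absorbed
before that belong to no other member.  The last clause tells which member that can
be, when the walk is known to avoid all others. *)
Lemma grow_family (I : eqType) E (B : I -> pred V) Z i j v w :
  symmetric E -> (forall k, conn E (B k)) -> disjoint_family B ->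
  B i v -> reach E Z v w -> B j w -> j != i ->
  exists B' : I -> pred V,
    [/\ forall k x, B k x -> B' k x,
        forall k x, B' k x -> B k x \/ Z x /\ k = i,
        forall k, conn E (B' k), disjoint_family B'
      & exists k, [/\ k != i, adjoining E (B' i) (B' k) & exists2 z, Z z & B k z]].
Proof.
move=> symE cB dB Bv [p [pp lp ap]] Bw ji.
elim: p v B cB dB Bv Bw pp lp ap => [|u p IH] v B cB dB Bv Bw /=.
  by move=> _ vw; rewrite vw in Bv; rewrite (dB _ _ _ Bw Bv) eqxx in ji.
case/andP=> Evu pu lp /and3P[Zv Zu ap].
case: (classic (exists k, k != i /\ B k u)) => [[k [ki Bku]]|nk].
  exists B; split=> //; first by left.
  by exists k; split=> //; [exists v, u | exists u].
pose B1 k : pred V := if k == i then predU (B i) (pred1 u) : pred V else B k.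
have B1i : B1 i = (predU (B i) (pred1 u) : pred V) by rewrite /B1 eqxx.
have B1k k : k != i -> B1 k = B k by rewrite /B1 => /negbTE->.
have sB k x : B k x -> B1 k x.
  by case: (eqVneq k i) => [->|/B1k->//]; rewrite B1i /= => ->.
have cB1 k : conn E (B1 k).
  case: (eqVneq k i) => [->|/B1k->//]; rewrite B1i.
  apply: connU => //; first exact: conn1.
  by exists v, u; split=> //=; right.
have dB1 : disjoint_family B1.
  have aux k x : k != i -> B k x -> B1 i x -> False.
    rewrite B1i => ki Bkx /= /orP[Bix|/eqP xu].
      by rewrite (dB _ _ _ Bkx Bix) eqxx in ki.
    by apply: nk; exists k; rewrite -xu.
  move=> k l x; case: (eqVneq k i) => [->|ki]; case: (eqVneq l i) => [->|li] //.
  - by rewrite (B1k _ li) => h1 h2; case: (aux _ _ li h2 h1).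
  - by rewrite (B1k _ ki) => h1 h2; case: (aux _ _ ki h1 h2).
  by rewrite !B1k //; apply: dB.
have [||//|||B' [s1 s2 c' d' [k [ki ad [z Zz Bz]]]]] := IH u B1 cB1 dB1.
- by rewrite B1i /= eqxx orbT.
- exact: sB.
- by [].
- by rewrite /= Zu.
exists B'; split=> //.
- by move=> l x /sB/s1.
- move=> l x /s2 [|]; last by right.
  case: (eqVneq l i) => [->|/B1k->]; last by left.
  by rewrite B1i => /= /orP[|/eqP->]; [left | right].
by exists k; split=> //; exists z => //; rewrite -(B1k _ ki).
Qed.

(** * Minors and thetas *)

(** The conditions of [is_minor K4] for a bare relation: supergraphs of the board
are handled as relations, without rebuilding a graph for each of them. *)
Definition has_K4_minor E : Prop := exists B : 'I_4 -> pred V,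
  [/\ forall i, exists x, B i x, forall i, conn E (B i), disjoint_family B
    & forall i j, i != j -> adjoining E (B i) (B j)].

Lemma adjoining_sym E A B : symmetric E -> adjoining E A B -> adjoining E B A.
Proof. by move=> symE [x [y [Ax By Exy]]]; exists y, x; rewrite symE. Qed.

Lemma K4_minor_of_sets E (A B C D : pred V) : symmetric E ->
  conn E A -> conn E B -> conn E C -> conn E D ->
  adjoining E A B -> adjoining E A C -> adjoining E A D ->
  adjoining E B C -> adjoining E B D -> adjoining E C D ->
  (forall x, ~~ [|| A x && B x, A x && C x, A x && D x, B x && C x, B x && D x
              | C x && D x]) ->
  has_K4_minor E.
Proof.
move=> symE cA cB cC cD AB AC AD BC BD CD dis.
pose F (i : 'I_4) := nth A [:: A; B; C; D] i.
have adj (u v : 'I_4) : u != v -> adjoining E (F u) (F v).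
  by case: u => [[|[|[|[|//]]]] iu]; case: v => [[|[|[|[|//]]]] iv] //= _;
     rewrite /F //=; apply: adjoining_sym.
exists F; split=> //.
- move=> u; have [v uv] : exists v : 'I_4, u != v.
    by case: u => [[|u] iu]; [exists (Ordinal (erefl (1 < 4))) | exists ord0].
  by have [x [y [Fx _ _]]] := adj _ _ uv; exists x.
- by case=> [[|[|[|[|//]]]] iu].
move=> u v x; move: (dis x).
case: u => [[|[|[|[|//]]]] iu]; case: v => [[|[|[|[|//]]]] iv] //=;
  rewrite /F /= => d h1 h2; try exact: val_inj;
  by move: d; rewrite h1 h2 /= ?orbT.
Qed.

Lemma K4_minor_sub E E' : subrel E E' -> has_K4_minor E -> has_K4_minor E'.
Proof.
move=> sE [B [B0 cB dB aB]]; exists B; split=> //.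
  by move=> u x y Bx By; apply: reach_sub (cB _ _ _ Bx By) => // v w _ _; apply: sE.
by move=> u v /aB [x [y [Bx By /sE Exy]]]; exists x, y.
Qed.

(** A minor model of K(2,3) whose two vertices of degree 3 are the single vertices
[a] and [b].  Connected sets replace three internally disjoint paths because
they can be enlarged freely. *)
Definition theta E a b (S : 'I_3 -> pred V) : Prop :=
  [/\ a != b, forall i, conn E (S i), disjoint_family S,
      forall i x, S i x -> (x != a) && (x != b)
    & forall i, adjoining E (pred1 a) (S i) /\ adjoining E (pred1 b) (S i)].

Lemma third_index (i k : 'I_3) : exists l : 'I_3, (l != i) && (l != k).
Proof.
case: i => [[|[|[|//]]] ?]; case: k => [[|[|[|//]]] ?];
 solve [by exists (@Ordinal 3 0 isT) | by exists (@Ordinal 3 1 isT)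
       | by exists (@Ordinal 3 2 isT)].
Qed.

(** After growing [S i] along the walk it is adjacent to some [S k]; then [S i],
[S k], [b], and [a] together with the third set are the branch sets.  So, in a
graph without K4 minor, the three sets of a theta lie in different components
of the graph minus its poles. *)
Lemma theta_K4_minor E a b (S : 'I_3 -> pred V) u v i j : symmetric E -> theta E a b S ->
  S i u -> S j v -> j != i ->
  reach E (fun z => (z != a) && (z != b)) u v -> has_K4_minor E.
Proof.
move=> symE [ab cS dS aS tS] Siu Sjv ji ruv.
have [T [sT T' cT dT [k [ki adj _]]]] :=
  grow_family symE cS dS Siu ruv Sjv ji.
have avT l x : T l x -> (x != a) && (x != b) by case/T' => [/aS|[]].
have [l /andP[li lk]] := third_index i k.
have tT m : adjoining E (pred1 a) (T m) /\ adjoining E (pred1 b) (T m).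
  by have [[x [y [? /sT ? ?]]] [x' [y' [? /sT ? ?]]]] := tS m;
    split; [exists x, y | exists x', y'].
apply: (@K4_minor_of_sets E (predU (pred1 a) (T l)) (pred1 b) (T i) (T k)) => //.
- apply: connU => //; first exact: conn1.
  by have [[x [y [? ? ?]]] _] := tT l; exists x, y; split=> //; right.
- exact: conn1.
- have [_ [x [y [/eqP-> Ty Eby]]]] := tT l.
  by exists y, b; rewrite symE /= Ty orbT eqxx.
- by have [[x [y [xa ? ?]]] _] := tT i; exists x, y; split=> //; rewrite /= (eqP xa) eqxx.
- by have [[x [y [xa ? ?]]] _] := tT k; exists x, y; split=> //; rewrite /= (eqP xa) eqxx.
- by have [_ ?] := tT i.
- by have [_ ?] := tT k.
move=> x /=; apply/negP.
have e m n : T m x -> T n x -> m != n -> False.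
  by move=> h1 h2; rewrite (dT _ _ _ h1 h2) eqxx.
case/or4P => [/andP[/orP[/eqP->|]]|/andP[/orP[/eqP->|]]|/andP[/orP[/eqP->|]]|].
- by rewrite (negbTE ab).
- by move=> /avT /andP[_ /negbTE->].
- by move=> /avT; rewrite eqxx.
- by move=> h1 h2; apply: (e _ _ h1 h2).
- by move=> /avT; rewrite eqxx.
- by move=> h1 h2; apply: (e _ _ h1 h2).
case/or3P=> /andP[].
- by move=> /eqP-> /avT; rewrite eqxx andbF.
- by move=> /eqP-> /avT; rewrite eqxx andbF.
by move=> h1 h2; apply: (e _ _ h1 h2); rewrite eq_sym.
Qed.

Definition same_pair x y : rel V :=
  fun u v => (u == x) && (v == y) || (u == y) && (v == x).

Definition add_edge E x y : rel V := fun u v => E u v || same_pair x y u v.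

Lemma same_pairC x y u v : same_pair x y u v = same_pair x y v u.
Proof. by rewrite /same_pair orbC; congr (_ || _); rewrite andbC. Qed.

Lemma add_edge_sym E x y : symmetric E -> symmetric (add_edge E x y).
Proof. by move=> symE u v; rewrite /add_edge symE same_pairC. Qed.

(** In a minor model that uses the edge [a b], the poles lie in branch sets [B i]
and [B j].  The other branch sets are pairwise adjacent and avoid the poles, so
they meet at most one set of the theta (otherwise [theta_K4_minor] applies).  A
set of the theta that they do not meet replaces the edge [a b]. *)
Lemma theta_add_edge E a b (S : 'I_3 -> pred V) : symmetric E -> theta E a b S ->
  has_K4_minor (add_edge E a b) -> has_K4_minor E.
Proof.
move=> symE thS [B [B0 cB dB aB]].
have [ab cS dS aS tS] := thS.
have noab (A : pred V) : ~~ (A a && A b) -> conn (add_edge E a b) A -> conn E A.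
  move=> nA cA x y Ax Ay; apply: reach_sub (cA _ _ Ax Ay) => // u v Au Av.
  case/orP=> // /orP[] /andP[/eqP eu /eqP ev]; move: nA;
    by rewrite -eu -ev Au Av.
have nab (A A' : pred V) : ~~ (A a && A' b) -> ~~ (A b && A' a) ->
    adjoining (add_edge E a b) A A' -> adjoining E A A'.
  move=> n1 n2 [x [y [Ax A'y]]]; case/orP=> [Exy|]; first by exists x, y.
  by case/orP=> /andP[/eqP ex /eqP ey]; [case/negP: n1 | case/negP: n2];
    rewrite -ex -ey Ax A'y.
case: (classic ((exists i, B i a) /\ (exists j, B j b))); last first.
  move=> no; exists B; split=> //.
    move=> u; apply: noab => //; apply/negP=> /andP[Ba Bb].
    by apply: no; split; exists u.
  move=> u v /aB; apply: nab; apply/negP=> /andP[h1 h2]; apply: no.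
    by split; [exists u | exists v].
  by split; [exists v | exists u].
case=> [[i Bia] [j Bjb]].
have av k x : k != i -> k != j -> B k x -> (x != a) && (x != b).
  move=> ki kj Bkx; apply/andP; split; apply/eqP=> ex; rewrite ex in Bkx.
    by rewrite (dB _ _ _ Bkx Bia) eqxx in ki.
  by rewrite (dB _ _ _ Bkx Bjb) eqxx in kj.
pose meets l := exists k x, [/\ k != i, k != j, S l x & B k x].
case: (classic (exists l, ~ meets l)) => [[l nl]|all_meet]; last first.
  have me l : meets l by apply: NNPP => nl; apply: all_meet; exists l.
  have [k [x [ki kj Sx Bx]]] := me ord0.
  have [k' [x' [k'i k'j Sx' Bx']]] := me ord_max.
  apply: (theta_K4_minor symE thS Sx Sx') => //.
  have cK m y z : m != i -> m != j -> B m y -> B m z ->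
      reach E (fun z => (z != a) && (z != b)) y z.
    move=> mi mj By Bz; apply: reach_sub (cB _ _ _ By Bz).
      by move=> u; apply: av.
    move=> u v Bu Bv /orP[//|/orP[]] /andP[/eqP eu /eqP ev].
      by have := av _ _ mi mj Bu; rewrite eu eqxx.
    by have := av _ _ mi mj Bv; rewrite ev eqxx.
  case: (eqVneq k k') => [e|kk']; first by apply: (cK k) => //; rewrite e.
  have [y [z [By Bz Eyz]]] := aB _ _ kk'.
  apply: reach_trans (cK _ _ _ ki kj Bx By) _.
  apply: reach_trans (cK _ _ _ k'i k'j Bz Bx').
  apply: reach_edge; [exact: (av k)|exact: (av k')|].
  case/orP: Eyz => // /orP[] /andP[/eqP ey /eqP ez].
    by have := av _ _ ki kj By; rewrite ey eqxx.
  by have := av _ _ k'i k'j Bz; rewrite ez eqxx.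
have [[a' [sa [/eqP ea Ssa Easa]]] [b' [sb [/eqP eb Ssb Ebsb]]]] := tS l.
rewrite {a'}ea in Easa; rewrite {b'}eb in Ebsb.
(* Either [a b] connects [B i] internally, and [S l] is added to [B i], or it
   joins [B i] to [B j], and [B i] is grown from [a] through [S l] towards [b]. *)
have [eij|ij] := eqVneq i j.
  pose U : pred V := predU (B i) (S l).
  pose B' k := if k == i then U else B k.
  have B'i : B' i = U by rewrite /B' eqxx.
  have B'k k : k != i -> B' k = B k by rewrite /B' => /negbTE->.
  have sB k x : B k x -> B' k x.
    by case: (eqVneq k i) => [->|/B'k->//]; rewrite B'i /U /= => ->.
  have Bib : B i b by rewrite eij.
  have sU x : S l x -> U x by rewrite /U /= orbC => ->.
  have sUB x : B i x -> U x by rewrite /U /= => ->.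
  have rab : reach E U a b.
    apply: (@reach_trans _ _ _ sa); first by apply: reach_edge; auto.
    apply: (@reach_trans _ _ _ sb); last by apply: reach_edge; rewrite 1?symE; auto.
    by apply: reach_sub (cS _ _ _ Ssa Ssb).
  have rU x y : B i x -> B i y -> reach E U x y.
    move=> Bx By; apply: reach_lift (cB _ _ _ Bx By) => // u v Bu Bv.
    case/orP=> [Euv|]; first by apply: reach_edge; auto.
    by case/orP=> /andP[/eqP-> /eqP->] //; apply: reach_sym.
  have aU x : U x -> reach E U a x.
    case/orP=> [/(rU _ _ Bia)//|Sx].
    apply: (@reach_trans _ _ _ sa); first by apply: reach_edge; auto.
    by apply: reach_sub (cS _ _ _ Ssa Sx).
  exists B'; split.
  - by move=> k; have [x Bx] := B0 k; exists x; apply: sB.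
  - move=> k; case: (eqVneq k i) => [->|ki]; rewrite ?B'i ?(B'k _ ki).
      move=> x y /aU ax /aU ay; apply: reach_trans ay.
      exact: reach_sym.
    by apply: noab => //; apply/negP=> /andP[/(av _ _ ki)]; rewrite -eij eqxx => /(_ ki).
  - have aux k x : k != i -> B k x -> U x -> False.
      move=> ki Bk /orP[Bi|Sl]; first by rewrite (dB _ _ _ Bk Bi) eqxx in ki.
      by apply: nl; exists k, x; split; rewrite -?eij.
    move=> k m x; case: (eqVneq k i) => [->|ki]; case: (eqVneq m i) => [->|mi] //.
    - by rewrite B'i (B'k _ mi) => h1 h2; case: (aux _ _ mi h2 h1).
    - by rewrite B'i (B'k _ ki) => h1 h2; case: (aux _ _ ki h1 h2).
    by rewrite !B'k //; apply: dB.
  move=> k m km.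
  have [x [y [Bx By Exy]]] : adjoining E (B k) (B m).
    apply: nab (aB _ _ km); apply/negP=> /andP[h1 h2].
      by rewrite (dB _ _ _ h1 Bia) (dB _ _ _ h2 Bib) eqxx in km.
    by rewrite (dB _ _ _ h1 Bib) (dB _ _ _ h2 Bia) eqxx in km.
  by exists x, y; split=> //; apply: sB.
have cBE k : conn E (B k).
  apply: noab => //; apply/negP=> /andP[h1 h2].
  by rewrite -(dB _ _ _ h1 Bia) -(dB _ _ _ h2 Bjb) eqxx in ij.
pose Z := predU (pred2 a b) (S l).
have rab : reach E Z a b.
  have sZ x : S l x -> Z x by rewrite /Z /= orbC => ->.
  apply: (@reach_trans _ _ _ sa).
    by apply: reach_edge => //; [rewrite /Z /= eqxx | apply: sZ].
  apply: (@reach_trans _ _ _ sb).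
    by apply: reach_sub (cS _ _ _ Ssa Ssb).
  by apply: reach_edge; rewrite 1?symE //; [apply: sZ | rewrite /Z /= eqxx orbT].
have ji : j != i by rewrite eq_sym.
have [B' [s1 _ c' d' [k [ki ad [z Zz Bz]]]]] :=
  grow_family symE cBE dB Bia rab Bjb ji.
have kj : k = j.
  apply: NNPP => /eqP kj; have := av _ _ ki kj Bz.
  case/orP: Zz => [/orP[] /eqP->|Sz]; rewrite ?eqxx ?andbF // => _.
  by apply: nl; exists k, z.
rewrite kj in ad; exists B'; split=> //.
  by move=> m; have [x Bx] := B0 m; exists x; apply: s1.
move=> m n mn.
case: (classic (B m a /\ B n b)) => [[/dB /(_ Bia)-> /dB /(_ Bjb)->] //|n1].
case: (classic (B m b /\ B n a)) => [[/dB /(_ Bjb)-> /dB /(_ Bia)->]|n2].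
  exact: adjoining_sym.
have [x [y [Bx By Exy]]] : adjoining E (B m) (B n).
  by apply: nab (aB _ _ mn); apply/negP=> /andP[h1 h2]; [apply: n1 | apply: n2].
by exists x, y; split=> //; apply: s1.
Qed.
End Connectivity.

(** * Induced paths *)

Section InducedPaths.
Variable V : eqType.
Implicit Types (E : rel V) (s p q : seq V) (a b u v x y z : V).

Definition begins_induced E x s : bool :=
  if s is y :: s' then E x y && all (fun z => ~~ E x z) s' else true.

Fixpoint induced E s : bool :=
  if s is x :: s' then begins_induced E x s' && induced E s' else true.

(** Here [p] lists the interior vertices only. *)
Definition induced_path E x p y : bool :=
  uniq (x :: rcons p y) && induced E (x :: rcons p y).

Lemma begins_induced_cat E x s a s2 :
  begins_induced E x (rcons s a ++ s2) =
  begins_induced E x (rcons s a) && all (fun z => ~~ E x z) s2.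
Proof. by case: s => [|h s] /=; rewrite ?andbT // all_cat andbA. Qed.

(** Cutting an induced path at an edge: the halves are induced and no edge but
[a b] joins them.  All surgery on paths and cycles below goes through this. *)
Lemma induced_cat E s1 a b s2 :
  induced E (rcons s1 a ++ b :: s2) =
  [&& induced E (rcons s1 a), induced E (b :: s2), E a b,
      allrel (fun u v => ~~ E u v) s1 (b :: s2) & all (fun z => ~~ E a z) s2].
Proof.
elim: s1 => [|x s1 IH].
  rewrite /=; move: (begins_induced E b s2) (induced E s2) (E a b).
  by move: (all _ s2); do 4!case.
rewrite rcons_cons cat_cons allrel_consl.
rewrite [LHS]/= begins_induced_cat IH [induced E (x :: _)]/=.
move: (begins_induced E x _) (all _ (b :: s2)) (induced E (b :: s2)).
move: (induced E _) (E a b) (allrel _ _ _) (all _ s2).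
by do 7!case.
Qed.

Lemma induced_catl E s1 s2 : induced E (s1 ++ s2) -> induced E s1.
Proof.
elim: s1 => //= x s1 IH /andP[bx /IH->]; rewrite andbT.
by case: s1 bx {IH} => //= y s1; rewrite all_cat => /and3P[-> ->].
Qed.

Lemma induced_catr E s1 s2 : induced E (s1 ++ s2) -> induced E s2.
Proof. by elim: s1 => //= x s1 IH /andP[_ /IH]. Qed.

Lemma induced_sorted E s : induced E s -> sorted E s.
Proof.
elim: s => //= x [|y s] //= IH /andP[/andP[-> _] /=].
exact: IH.
Qed.

Lemma induced_rev E s : symmetric E -> induced E s -> induced E (rev s).
Proof.
move=> symE; elim: s => //= x [|y s] IH //= /andP[/andP[Exy nx] /IH].
rewrite rev_cons => iy; rewrite rev_cons -cats1 rev_cons induced_cat iy /= symE Exy allrel1r all_rev.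
by rewrite andbT; apply: sub_all nx => z; rewrite symE.
Qed.

Lemma eq_in_induced E E' s : {in s &, E =2 E'} -> induced E s = induced E' s.
Proof.
elim: s => //= x s IH eE; rewrite IH; last first.
  by move=> u v us vs; apply: eE; rewrite inE ?us ?vs orbT.
congr (_ && _); case: s eE {IH} => //= y s eE.
rewrite eE ?inE ?eqxx ?orbT //; congr (_ && _).
by apply: eq_in_all => z zs; rewrite eE // !inE ?eqxx ?zs ?orbT.
Qed.

Lemma induced_adjacent E s x y : symmetric E -> irreflexive E ->
  induced E s -> x \in s -> y \in s -> E x y ->
  exists s1 s2, s = s1 ++ [:: x; y] ++ s2 \/ s = s1 ++ [:: y; x] ++ s2.
Proof.
move=> symE irrE; elim: s => //= z s IH /andP[bz iz].
have aux u : begins_induced E z s -> u \in s -> E z u -> exists s2, s = u :: s2.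
  case: (s) => //= h s2 /andP[_ /allP nz]; rewrite inE => /orP[/eqP->|us].
    by exists s2.
  by rewrite (negbTE (nz _ us)).
rewrite !inE => /orP[/eqP xz|xs] /orP[/eqP yz|ys] Exy.
- by rewrite xz yz irrE in Exy.
- rewrite xz in Exy *; have [s2 ->] := aux _ bz ys Exy.
  by exists [::], s2; left.
- rewrite yz in Exy *; rewrite symE in Exy; have [s2 ->] := aux _ bz xs Exy.
  by exists [::], s2; right.
have [s1 [s2 [->|->]]] := IH iz xs ys Exy; exists (z :: s1), s2; by [left | right].
Qed.

Lemma induced_path_rev E x p y : symmetric E ->
  induced_path E x p y -> induced_path E y (rev p) x.
Proof.
move=> symE /andP[up ip].
have e : y :: rcons (rev p) x = rev (x :: rcons p y).
  by rewrite rev_cons rev_rcons.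
by rewrite /induced_path e rev_uniq up induced_rev.
Qed.

Lemma last_split (P : pred V) s : has P s ->
  exists s1 z s2, [/\ s = s1 ++ z :: s2, P z & all (predC P) s2].
Proof.
elim: s => //= x s IH; case hs: (has P s).
  by have [s1 [z [s2 [-> Pz a2]]]] := IH hs; exists (x :: s1), z, s2.
rewrite orbF => Px; exists [::], x, s; split=> //.
by rewrite all_predC hs.
Qed.

(** By induction the tail of the walk becomes an induced path; [x] then jumps to
its last neighbour on that path. *)
Lemma walk_induced E x p : path E x p -> exists q,
  [/\ uniq (x :: q), induced E (x :: q), last x q = last x p & {subset q <= p}].
Proof.
elim: p x => [|u p IH] x /=; first by exists [::].
case/andP=> Exu pu; have [q [uq iq lq sq]] := IH u pu.
have sub : {subset u :: q <= u :: p}.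
  by move=> z; rewrite !inE => /orP[->//|/sq->]; rewrite orbT.
case xq: (x \in u :: q).
  have [s1 [s2 e]] : exists s1 s2, u :: q = s1 ++ x :: s2.
    by case/splitPr: xq => s1 s2; exists s1, s2.
  exists s2; split.
  - by move: uq; rewrite e cat_uniq => /and3P[].
  - by move: iq; rewrite e => /induced_catr.
  - by rewrite -lq -(last_cons x u q) e last_cat.
  by move=> z zs; apply: sub; rewrite e mem_cat inE zs !orbT.
have /last_split [s1 [z [s2 [e Exz nx]]]] : has (E x) (u :: q) by rewrite /= Exu.
exists (z :: s2); split.
- rewrite cons_uniq; apply/andP; split.
    by apply: contraFN xq => h; rewrite e mem_cat h orbT.
  by move: uq; rewrite e cat_uniq => /and3P[].
- rewrite /= Exz nx /=; by move: iq; rewrite e => /induced_catr.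
- by rewrite -lq -(last_cons x u q) e last_cat.
by move=> w ws; apply: sub; rewrite e mem_cat ws orbT.
Qed.

Lemma conn_induced_path E (S : pred V) a b : symmetric E -> conn E S -> a != b ->
  ~~ S b -> adjoining E (pred1 a) S -> adjoining E (pred1 b) S ->
  exists p, induced_path E a p b /\ all S p.
Proof.
move=> symE cS ab nSb [a' [s [/eqP-> Ss Eas]]] [b' [t [/eqP-> St Ebt]]].
have [r [pr lr ar]] := cS _ _ Ss St.
have pw : path E a (rcons (s :: r) b).
  by rewrite rcons_path /= Eas pr lr symE.
have [q [uq iq lq sq]] := walk_induced pw.
rewrite last_rcons in lq.
case/lastP: q uq iq lq sq => [|q b''].
  by move=> _ _ /= e; rewrite e eqxx in ab.
move=> uq iq; rewrite last_rcons => e; rewrite e in uq iq * => sq.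
exists q; rewrite /induced_path uq iq; split=> //; apply/allP => z zq.
have : z \in rcons (s :: r) b by apply: sq; rewrite mem_rcons inE zq orbT.
rewrite mem_rcons inE => /orP[/eqP zb|/(allP ar)//].
by move: uq; rewrite /= rcons_uniq -zb zq /= andbF.
Qed.

(** * Weights of coloured paths *)

Implicit Type col : V -> V -> bool.

(** Modulo 3 the colours are 1 and -1, so [s + weight c] vanishes for exactly one
colour unless [s] does. *)
Definition weight (c : bool) : nat := if c then 1 else 2.

Fixpoint path_weight col s : nat :=
  if s is x :: s' then
    (if s' is y :: _ then weight (col x y) else 0) + path_weight col s'
  else 0.

Lemma path_weight_cat col s1 a s2 : path_weight col (s1 ++ a :: s2) =
  path_weight col (rcons s1 a) + path_weight col (a :: s2).
Proof.
elim: s1 => [|x s1 IH] /=; first by rewrite addn0.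
by rewrite IH /=; case: s1 {IH} => [|y s1] /=; rewrite !addnA.
Qed.

Lemma path_weight_rev col s : (forall u v, col u v = col v u) ->
  path_weight col (rev s) = path_weight col s.
Proof.
move=> symc; elim: s => //= x [|y s] IH //.
rewrite rev_cons rev_cons -cats1 cat_rcons path_weight_cat -rev_cons IH /=.
by rewrite symc; lia.
Qed.

Lemma eq_path_weight E col col' s : sorted E s ->
  (forall u v, E u v -> col u v = col' u v) ->
  path_weight col s = path_weight col' s.
Proof.
move=> + eC; elim: s => //= x [|y s] IH //= /andP[Exy ps].
by rewrite (eC _ _ Exy); congr (_ + _); apply: IH.
Qed.

Definition del_edge E x y : rel V := fun u v => E u v && ~~ same_pair x y u v.

(** Every induced cycle has nonzero weight modulo 3.  A cycle is presented as one
of its edges [u v] and the induced path that remains when this edge is deleted;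
[p] nonempty excludes the edge taken twice. *)
Definition good E col : Prop := forall u p v, p != [::] -> E u v ->
  induced_path (del_edge E u v) u p v ->
  ~~ (3 %| path_weight col (u :: rcons p v) + weight (col u v)).

(** Two induced paths without common interior vertex or edge between their
interiors form an induced cycle.  It is presented by the first edge of [q]: the
remaining path follows [q] to [y] and returns along [p]. *)
Lemma good_two_paths E col x p q y : symmetric E ->
  (forall u v, col u v = col v u) -> good E col ->
  ~~ E x y -> induced_path E x p y -> induced_path E x q y ->
  (forall u v, u \in p -> v \in q -> (u != v) && ~~ E u v) ->
  ~~ (3 %| path_weight col (x :: rcons p y) + path_weight col (x :: rcons q y)).
Proof.
move=> symE symc gE nExy ip iq dpq.
case: q iq dpq => [|q0 q'] iq dpq.
  by case/and3P: iq => _ /=; rewrite (negbTE nExy).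
have Exq0 : E x q0 by case/and3P: iq => _ /andP[].
have nxq' u : u \in q' -> ~~ E x u.
  case/and3P: iq => _ /andP[_ /allP h] _ uq; apply: h.
  by rewrite mem_rcons inE uq orbT.
have [xnq xny ynq uq] : [/\ x \notin q0 :: q', x != y, y \notin q0 :: q' & uniq (q0 :: q')].
  case/andP: iq => + _; rewrite cons_uniq rcons_uniq mem_rcons inE negb_or.
  by case/and3P=> /andP[].
have [xnp ynp up] : [/\ x \notin p, y \notin p & uniq p].
  case/andP: ip => + _; rewrite cons_uniq rcons_uniq mem_rcons inE negb_or.
  by case/and3P=> /andP[].
have pnot u : u \in q0 :: q' -> u \notin p.
  by move=> uq'; apply/negP=> up'; have := dpq _ _ up' uq'; rewrite eqxx.
set D := del_edge E q0 x.
have DE u v : u != x -> v != x -> D u v = E u v.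
  move=> ux vx; rewrite /D /del_edge /same_pair (negbTE ux) (negbTE vx).
  by rewrite /= andbF andbT.
have DE' u v : u != q0 -> v != q0 -> D u v = E u v.
  move=> ux vx; rewrite /D /del_edge /same_pair (negbTE ux) (negbTE vx).
  by rewrite /= andbF andbT.
have qx u : u \in q0 :: q' -> u != x.
  by move=> uq'; apply: contraNneq xnq => <-.
have eseq : q0 :: rcons (q' ++ y :: rev p) x =
    rcons (belast q0 q') (last q0 q') ++ y :: rcons (rev p) x.
  by rewrite -lastI rcons_cat.
have mq1 u : u \in belast q0 q' -> u \in q0 :: q' by apply: mem_belast.
have mlast : last q0 q' \in q0 :: q' by apply: mem_last.
have iq' : induced E (rcons (belast q0 q') (last q0 q') ++ y :: [::]).
  by case/and3P: iq => _ _; rewrite cats1 -lastI.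
have nD u v : u \in q0 :: q' -> v \in rcons (rev p) x -> ~~ D u v.
  move=> uq'; rewrite mem_rcons inE mem_rev => /orP[/eqP->|vp].
    rewrite /D /del_edge /same_pair; move: uq'; rewrite inE => /orP[/eqP->|uq'].
      by rewrite !eqxx /= andbF.
    by rewrite symE (negbTE (nxq' _ uq')).
  by rewrite /D /del_edge symE; case/andP: (dpq _ _ vp uq') => _ /negbTE->.
have := @gE q0 (q' ++ y :: rev p) x.
rewrite symE Exq0 /induced_path eseq -/D symc.
set r := rcons (rev p) x in eseq nD *.
have er : y :: r = rev (x :: rcons p y) by rewrite rev_cons rev_rcons.
move=> h; have {h} : ~~ (3 %| path_weight col
    (rcons (belast q0 q') (last q0 q') ++ y :: r) + weight (col x q0)).
  apply: h => //; first by case: (q').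
  apply/andP; split.
    rewrite -lastI cat_uniq uq er rev_uniq; case/andP: ip => -> _.
    rewrite andbT; apply/hasPn => u; rewrite mem_rev inE mem_rcons inE.
    case/or3P => [/eqP->|/eqP->|up'] //.
    by apply/negP=> /pnot; rewrite up'.
  rewrite induced_cat in iq'; case/and5P: iq' => i1 _ Ely nly _.
  rewrite induced_cat.
  have lx := qx _ mlast.
  apply/and5P; split.
  - rewrite -(@eq_in_induced E) // => u v; rewrite -lastI => /qx ux /qx vx.
    by rewrite DE.
  - rewrite -/(induced D (y :: r)) er -(@eq_in_induced E).
      by apply: induced_rev => //; case/andP: ip.
    have nq0 u : u \in rev (x :: rcons p y) -> u != q0.
      rewrite mem_rev inE mem_rcons inE => h; apply: contraTneq h => ->.
      rewrite !negb_or pnot ?inE ?eqxx // andbT; move: xnq ynq.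
      by rewrite !inE !negb_or => /andP[+ _] /andP[+ _]; rewrite ![q0 == _]eq_sym => -> ->.
    by move=> u v /nq0 uq0 /nq0 vq0; rewrite DE'.
  - by rewrite DE // eq_sym.
  - apply/allrelP=> u v uq'; rewrite inE => /orP[/eqP->|vr].
      rewrite DE; [|by apply/qx/mq1|by rewrite eq_sym].
      by have /= := allrelP nly u y uq'; apply; rewrite inE.
    by apply: nD => //; apply: mq1.
  by apply/allP=> v vr; apply: nD.
rewrite path_weight_cat er path_weight_rev // -lastI.
have -> : path_weight col (x :: rcons (q0 :: q') y) =
  weight (col x q0) + path_weight col (rcons (q0 :: q') y) by [].
by rewrite addnC addnA [path_weight col (x :: _) + _]addnC addnAC.
Qed.
End InducedPaths.

(** * Adding a coloured edge *)

Section Colouring.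
Variable V : eqType.
Implicit Types (E : rel V) (s p q t : seq V) (a b u v x y z : V).
Implicit Type col : V -> V -> bool.

Definition add_colour col x y c : V -> V -> bool :=
  fun u v => if same_pair x y u v then c else col u v.

Lemma same_pair_swap x y u v : same_pair x y u v = same_pair u v x y.
Proof.
rewrite /same_pair ![x == _]eq_sym ![y == _]eq_sym.
by congr (_ || _); rewrite andbC.
Qed.

Lemma path_weight_join col s1 a b s2 :
  path_weight col (rcons s1 a ++ b :: s2) =
  path_weight col (rcons s1 a) + weight (col a b) + path_weight col (b :: s2).
Proof. by rewrite cat_rcons path_weight_cat addnA. Qed.

(** An induced cycle through the new edge [x y] need not be presented by that edge.
If it is presented by [u v], with [x y] at the place where the list of vertices
is cut into [rcons s1 a] and [b :: s2], exchanging the two parts presents it by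
[x y]. *)
Lemma induced_rotate E x y u v s1 a b s2 t1 t2 : symmetric E -> ~~ E a b ->
  same_pair x y a b -> ~~ same_pair x y u v ->
  let D := del_edge (add_edge E x y) u v in
  E u v -> rcons s1 a = u :: t1 -> b :: s2 = rcons t2 v ->
  uniq (rcons s1 a ++ b :: s2) -> induced D (rcons s1 a ++ b :: s2) ->
  induced_path E b (s2 ++ s1) a.
Proof.
move=> symE nEab xyab nxyuv D Euv e1 e2 us iD.
have es : b :: rcons (s2 ++ s1) a = (b :: s2) ++ rcons s1 a.
  by rewrite rcons_cat.
have [dis1 dis2] : (forall z, z \in rcons s1 a -> z \notin b :: s2) /\
    (forall z, z \in b :: s2 -> z \notin rcons s1 a).
  move: us; rewrite cat_uniq => /and3P[_ /hasPn h _]; split=> // z z1.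
  by apply/negP=> z2; have := h _ z2; rewrite z1.
have Ea z w : same_pair x y z w -> (z == a) && (w == b) || (z == b) && (w == a).
  move: xyab; rewrite /same_pair => /orP[] /andP[/eqP-> /eqP->] //.
  by rewrite orbC.
have [us1 us2] : uniq (u :: t1) /\ uniq (rcons t2 v).
  by move: us; rewrite e1 e2 cat_uniq => /and3P[-> _ ->].
have u1 : u \in rcons s1 a by rewrite e1 inE eqxx.
have v2 : v \in b :: s2 by rewrite e2 mem_rcons inE eqxx.
have a1 : a \in rcons s1 a by rewrite mem_rcons inE eqxx.
have b2 : b \in b :: s2 by rewrite inE eqxx.
have DE1 z w : z \in rcons s1 a -> w \in rcons s1 a -> D z w = E z w.
  move=> z1 w1; rewrite /D /del_edge /add_edge.
  have -> : same_pair u v z w = false.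
    apply/negP=> /orP[] /andP[/eqP h1 /eqP h2].
      by move: (dis1 _ w1); rewrite h2 v2.
    by move: (dis1 _ z1); rewrite h1 v2.
  rewrite andbT; case h: (same_pair x y z w); last by rewrite orbF.
  case/orP: (Ea _ _ h) => /andP[/eqP h1 /eqP h2].
    by move: (dis1 _ w1); rewrite h2 b2.
  by move: (dis1 _ z1); rewrite h1 b2.
have DE2 z w : z \in b :: s2 -> w \in b :: s2 -> D z w = E z w.
  move=> z1 w1; rewrite /D /del_edge /add_edge.
  have -> : same_pair u v z w = false.
    apply/negP=> /orP[] /andP[/eqP h1 /eqP h2].
      by move: (dis2 _ z1); rewrite h1 u1.
    by move: (dis2 _ w1); rewrite h2 u1.
  rewrite andbT; case h: (same_pair x y z w); last by rewrite orbF.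
  case/orP: (Ea _ _ h) => /andP[/eqP h1 /eqP h2].
    by move: (dis2 _ z1); rewrite h1 a1.
  by move: (dis2 _ w1); rewrite h2 a1.
rewrite induced_cat in iD; case/and5P: iD => i1 i2 _ /allrelP n1 /allP n2.
have only z w : z \in b :: s2 -> w \in rcons s1 a -> E z w -> z = v /\ w = u.
  move=> zs ws Ezw; case Dwz: (D w z).
    move: ws; rewrite mem_rcons inE => /orP[/eqP wa|ws]; last first.
      by have := n1 _ _ ws zs; rewrite Dwz.
    move: zs; rewrite inE => /orP[/eqP zb|zs].
      by rewrite wa zb symE (negbTE nEab) in Ezw.
    by have := n2 _ zs; rewrite -wa Dwz.
  move: Dwz; rewrite /D /del_edge /add_edge symE Ezw /= => /negbFE.
  case/orP=> /andP[/eqP wu /eqP zv] //.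
  by move: (dis2 _ zs); rewrite zv u1.
rewrite /induced_path es uniq_catC us andTb.
move: i1 i2; rewrite (eq_in_induced DE1) (eq_in_induced DE2) => i1 i2.
have i1' : induced E (u :: t1) by rewrite -e1.
have i2' : induced E (rcons t2 v) by rewrite -e2.
rewrite e2 e1 induced_cat i1' i2' symE Euv !andTb.
apply/andP; split.
  apply/allrelP=> z w zt wt; apply/negP=> Ezw.
  have [] := only z w _ _ Ezw; rewrite ?e1 ?e2 ?mem_rcons ?inE ?zt ?orbT //.
  by move=> zv _; move: us2; rewrite rcons_uniq -zv zt.
apply/allP=> w wt; apply/negP=> Evw.
have [] := only v w _ _ Evw; rewrite ?e1 ?e2 ?mem_rcons ?inE ?wt ?eqxx ?orbT //.
by move=> _ wu; move: us1; rewrite /= -wu wt.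
Qed.

(** The only new induced cycles contain the new edge, and deleting it from them
leaves the induced paths from [x] to [y] of the hypothesis. *)
Lemma good_add_edge E col x y c : symmetric E -> irreflexive E ->
  (forall u v, col u v = col v u) -> good E col -> x != y -> ~~ E x y ->
  (forall p, induced_path E x p y ->
     ~~ (3 %| path_weight col (x :: rcons p y) + weight c)) ->
  good (add_edge E x y) (add_colour col x y c).
Proof.
move=> symE irrE symc gE xy nExy hc u p v p0 Ruv ip.
set E1 := add_edge E x y in Ruv ip; set col1 := add_colour col x y c.
have colE z w : E z w -> col z w = col1 z w.
  rewrite /col1 /add_colour; case h: (same_pair x y z w) => //.
  case/orP: h => /andP[/eqP-> /eqP->]; first by rewrite (negbTE nExy).
  by rewrite symE (negbTE nExy).
have hc' p' : induced_path E y p' x ->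
    ~~ (3 %| path_weight col (y :: rcons p' x) + weight c).
  move=> /(induced_path_rev symE)/hc.
  have -> : x :: rcons (rev p') y = rev (y :: rcons p' x).
    by rewrite rev_cons rev_rcons.
  by rewrite path_weight_rev.
have pwE s : induced E s -> path_weight col1 s = path_weight col s.
  by move=> /induced_sorted h; rewrite -(@eq_path_weight _ E col col1).
have [xuv|nxuv] := boolP (same_pair x y u v).
  have DE : {in u :: rcons p v &, del_edge E1 u v =2 E}.
    move=> z w _ _; rewrite /del_edge /E1 /add_edge.
    have -> : same_pair u v z w = same_pair x y z w.
      case/orP: xuv => /andP[/eqP-> /eqP-> //].
      by rewrite /same_pair orbC.
    case h: (same_pair x y z w); last by rewrite orbF andbT.
    rewrite andbF; apply/esym/negbTE.
    by case/orP: h => /andP[/eqP-> /eqP->] //; rewrite symE.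
  have {}ip : induced_path E u p v by move: ip; rewrite /induced_path (eq_in_induced DE).
  rewrite pwE; last by case/andP: ip.
  have -> : col1 u v = c by rewrite /col1 /add_colour xuv.
  case/orP: xuv => /andP[/eqP eu /eqP ev]; rewrite eu ev in ip *.
    exact: hc.
  exact: hc'.
have Euv : E u v by move: Ruv; rewrite /E1 /add_edge (negbTE nxuv) orbF.
have c1uv : col1 u v = col u v by rewrite -colE.
(* With both ends on the induced cycle, the new edge is one of its edges, but
   not the one that presents it. *)
have [/andP[xs ys]|nxys] := boolP ((x \in u :: rcons p v) && (y \in u :: rcons p v)).
  have symD : symmetric (del_edge E1 u v).
    move=> z w; rewrite /del_edge same_pairC.
    congr (_ && _); exact: add_edge_sym.
  have irrD : irreflexive (del_edge E1 u v).
    move=> z; rewrite /del_edge /E1 /add_edge irrE /=.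
    rewrite /same_pair; case: (eqVneq z x) => [->|]; rewrite /= ?andbF //.
    by rewrite (negbTE xy).
  have Dxy : del_edge E1 u v x y.
    rewrite /del_edge /E1 /add_edge -same_pair_swap nxuv.
    by rewrite /same_pair !eqxx orbT.
  have [us iD] := andP ip.
  have key a b s1 s2 : same_pair x y a b ->
      u :: rcons p v = s1 ++ [:: a; b] ++ s2 ->
      ~~ (3 %| path_weight col1 (u :: rcons p v) + weight (col1 u v)).
    move=> xyab es.
    have nEab : ~~ E a b by case/orP: xyab => /andP[/eqP-> /eqP->] //; rewrite symE.
    have {}es : u :: rcons p v = rcons s1 a ++ b :: s2 by rewrite es cat_rcons.
    have [t1 e1] : exists t1, rcons s1 a = u :: t1.
      by case: (s1) es => [|u' s1'] /= [-> _]; [exists [::] | exists (rcons s1' a)].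
    have [t2 e2] : exists t2, b :: s2 = rcons t2 v.
      exists (belast b s2); rewrite lastI; congr rcons.
      by move/(congr1 (last u)): es; rewrite last_cat last_cons last_rcons => ->.
    rewrite es in us iD *.
    have ipE := induced_rotate symE nEab xyab nxuv Euv e1 e2 us iD.
    have hh : ~~ (3 %| path_weight col (b :: rcons (s2 ++ s1) a) + weight c).
      by case/orP: xyab => /andP[/eqP ea /eqP eb]; rewrite ea eb in ipE *;
        [apply: hc' | apply: hc].
    have i1 : induced E (rcons s1 a).
      case/andP: ipE => _; rewrite rcons_cat -cat_cons; exact: induced_catr.
    have i2 : induced E (b :: s2).
      case/andP: ipE => _; rewrite rcons_cat -cat_cons; exact: induced_catl.
    rewrite path_weight_join !pwE // c1uv.
    have -> : col1 a b = c by rewrite /col1 /add_colour xyab.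
    move: hh; rewrite rcons_cat -cat_cons e1 e2 path_weight_join.
    rewrite -e1 -e2 (symc v u) => hh; apply: contra hh.
    by rewrite -addnA addnC addnA.
  have [s1 [s2 [es|es]]] := induced_adjacent symD irrD iD xs ys Dxy.
    by apply: (key x y s1 s2) => //; rewrite /same_pair !eqxx.
  by apply: (key y x s1 s2) => //; rewrite /same_pair !eqxx orbT.
have nsp z w : z \in u :: rcons p v -> w \in u :: rcons p v ->
    same_pair x y z w = false.
  move=> zs ws; apply/negP=> /orP[] /andP[/eqP h1 /eqP h2]; case/negP: nxys;
    by rewrite -h1 -h2 zs ws.
have DE : {in u :: rcons p v &, del_edge E1 u v =2 del_edge E u v}.
  by move=> z w zs ws; rewrite /del_edge /E1 /add_edge nsp // orbF.
have {}ip : induced_path (del_edge E u v) u p v.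
  by move: ip; rewrite /induced_path (eq_in_induced DE).
rewrite c1uv -(@eq_path_weight _ (del_edge E u v) col col1).
- exact: gE.
- by apply: induced_sorted; case/andP: ip.
by move=> z w /andP[/colE].
Qed.

Lemma path_interior E x p y : symmetric E -> sorted E (x :: rcons p y) ->
  p != [::] ->
  [/\ conn E (mem p), adjoining E (pred1 x) (mem p)
    & adjoining E (pred1 y) (mem p)].
Proof.
move=> symE sp p0; split.
- apply: conn_seq => //; move: sp; rewrite -cats1 -cat1s => /cat_sorted2[_].
  by case/cat_sorted2.
- case: p sp p0 => //= h p /andP[Exh _] _.
  by exists x, h; rewrite /= inE !eqxx.
case/lastP: p sp p0 => // p h sp _; exists y, h; rewrite /= mem_rcons inE !eqxx.
split=> //; rewrite symE; move: sp; rewrite /= !rcons_path last_rcons.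
by case/andP.
Qed.

Lemma theta_of_paths E a b p q r : symmetric E -> a != b ->
  (forall s, s \in [:: p; q; r] ->
    [/\ s != [::], sorted E (a :: rcons s b), a \notin s & b \notin s]) ->
  (forall z, [&& ~~ ((z \in p) && (z \in q)), ~~ ((z \in p) && (z \in r))
     & ~~ ((z \in q) && (z \in r))]) ->
  exists S, theta E a b S.
Proof.
move=> symE ab ok dis; pose F (i : 'I_3) := nth p [:: p; q; r] i.
have okF i : [/\ F i != [::], sorted E (a :: rcons (F i) b), a \notin F i & b \notin F i].
  by apply: ok; apply: mem_nth.
exists (fun i => mem (F i)); split=> //.
- by move=> i; have [h1 h2 _ _] := okF i; have [] := path_interior symE h2 h1.
- move=> i j z; have /and3P[] := dis z.
  by case: i => [[|[|[|//]]] ?]; case: j => [[|[|[|//]]] ?]; rewrite /F /=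
    => d1 d2 d3 h1 h2; try exact: val_inj; move: d1 d2 d3; rewrite h1 h2.
- move=> i z /= zF; have [_ _ na nb] := okF i.
  by apply/andP; split; apply: contraTneq zF => ->.
by move=> i; have [h1 h2 _ _] := okF i; have [] := path_interior symE h2 h1.
Qed.

Lemma sorted_join E s x t y s' : sorted E (rcons s x) ->
  sorted E (x :: rcons t y) -> sorted E (y :: s') ->
  sorted E (rcons s x ++ t ++ y :: s').
Proof.
move=> h1 /= h2 h3; rewrite cat_rcons sorted_cat_cons h1 /= -cat_rcons.
by rewrite cat_path h2 last_rcons.
Qed.

(** The branch sets are the two ends and the two interiors. *)
Lemma chord_K4_minor E x y p q : symmetric E -> x != y -> E x y ->
  p != [::] -> sorted E (x :: rcons p y) -> uniq (x :: rcons p y) ->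
  q != [::] -> sorted E (x :: rcons q y) -> uniq (x :: rcons q y) ->
  (forall z, z \in p -> z \notin q) ->
  adjoining E (mem p) (mem q) -> has_K4_minor E.
Proof.
move=> symE xy Exy p0 sp up q0 sq uq dpq apq.
have [cp xp yp] := path_interior symE sp p0.
have [cq xq yq] := path_interior symE sq q0.
have av r : uniq (x :: rcons r y) -> x \notin r /\ y \notin r.
  rewrite cons_uniq rcons_uniq mem_rcons inE negb_or.
  by case/and3P=> /andP[_ ->] ->.
have [[xnp ynp] [xnq ynq]] := (av _ up, av _ uq).
apply: (@K4_minor_of_sets _ E (pred1 x) (pred1 y) (mem p) (mem q)) => //.
- exact: conn1.
- exact: conn1.
- by exists x, y; rewrite /= !eqxx.
move=> z /=; apply/negP.
case/or4P=> [/andP[/eqP-> /eqP e]|/andP[/eqP-> h]|/andP[/eqP-> h]|].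
- by rewrite e eqxx in xy.
- by rewrite h in xnp.
- by rewrite h in xnq.
case/or3P=> /andP[]; [move=> /eqP-> h|move=> /eqP-> h|move=> /dpq h1 h2].
- by rewrite h in ynp.
- by rewrite h in ynq.
by rewrite h2 in h1.
Qed.

(** The paths part after [a]; [b] is the first vertex of the second path, after
[a], that lies on the first one. *)
Lemma first_divergence x p q : uniq (x :: p) -> uniq (x :: q) ->
  last x p = last x q -> p = q \/ exists s a p1 b p2 q1 q2,
  [/\ x :: p = s ++ a :: p1 ++ b :: p2, x :: q = s ++ a :: q1 ++ b :: q2,
      forall z, z \in q1 -> z \notin x :: p & p1 != [::] \/ q1 != [::]].
Proof.
elim: p x q => [|u p IH] x q up uq /= lpq.
  left; case/lastP: q uq lpq => // q y; rewrite last_rcons => + e.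
  by rewrite e /= mem_rcons inE eqxx.
case: q uq lpq => [|v q] uq /= lpq.
  by move: up; rewrite /= -lpq mem_last.
have [uv|uv] := eqVneq u v.
  have [||//|<-|] := IH u q; rewrite ?uv.
  - by rewrite -uv; case/andP: up.
  - by case/andP: uq.
  - by rewrite -lpq uv.
  - by left.
  case=> s [a [p1 [b [p2 [q1 [q2 [e1 e2 d ne]]]]]]].
  right; exists (x :: s), a, p1, b, p2, q1, q2; split=> //.
  - by rewrite cat_cons -e1.
  - by rewrite cat_cons -e2.
  move=> z zq; rewrite inE negb_or d // andbT.
  apply: contraTneq zq => ->; move: uq => /andP[+ _]; rewrite e2.
  by apply: contra => h; rewrite mem_cat inE mem_cat h !orbT.
right.
have hq : has (mem (u :: p)) (v :: q).
  apply/hasP; exists (last v q); first exact: mem_last.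
  by rewrite -lpq; exact: mem_last.
have [q1 [b [q2 [eq bp nq1]]]] : exists q1 b q2,
    [/\ v :: q = q1 ++ b :: q2, b \in u :: p & forall z, z \in q1 -> z \notin u :: p].
  case: (split_find hq) => b q1 q2 bp /hasPn nq1.
  by exists q1, b, q2; rewrite cat_rcons.
have [p1 [p2 ep]] : exists p1 p2, u :: p = p1 ++ b :: p2.
  by case/splitPr: bp => p1 p2; exists p1, p2.
exists [::], x, p1, b, p2, q1, q2; split.
- by rewrite ep.
- by rewrite eq.
- move=> z zq; rewrite in_cons negb_or nq1 // andbT.
  apply: contraTneq zq => ->; case/andP: uq => + _; rewrite eq.
  by apply: contra => h; rewrite mem_cat h.
case: p1 q1 ep eq {nq1} => [|? ?] [|? ?]; [|by right|by left|by left].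
by move=> [eu _] [ev _]; rewrite eu ev eqxx in uv.
Qed.

(** The paths [p] and [q] part at [a] and meet again at [b].  If these are not both
ends, the two segments between them and the way from [a] back to [x], along [t]
to [y], and back to [b] are three internally disjoint paths, hence a theta.  The
graph [E'] may be larger than [E]: this allows [t] to be empty, when [E']
contains the edge [x y]. *)
Lemma detour E E' x p q y t : symmetric E' -> subrel E E' ->
  induced_path E x p y -> induced_path E x q y -> p != q ->
  sorted E' (x :: rcons t y) -> uniq (x :: rcons t y) ->
  (forall z, z \in t -> z \notin p /\ z \notin q) ->
  (forall z, z \in p -> z \notin q) \/
  exists a b p1 S,
    [/\ induced_path E a p1 b, ~~ E a b, size p1 < size p & theta E' a b S].
Proof.
move=> symE' sE /andP[up ip] /andP[uq iq] npq st ut dt.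
have [|e|[s [a [p1 [b [p2 [q1 [q2 [e1 e2 d ne]]]]]]]]] := first_divergence up uq.
- by rewrite !last_rcons.
- by case/rcons_inj: e npq => ->; rewrite eqxx.
have i1 : induced E (a :: rcons p1 b).
  by move: ip; rewrite e1 => /induced_catr; rewrite -cat_rcons -cat_cons => /induced_catl.
have i2 : induced E (a :: rcons q1 b).
  by move: iq; rewrite e2 => /induced_catr; rewrite -cat_rcons -cat_cons => /induced_catl.
have [p10 q10 nab] : [/\ p1 != [::], q1 != [::] & ~~ E a b].
  have nE r : r != [::] -> induced E (a :: rcons r b) -> ~~ E a b.
    case: r => //= h r _ /andP[/andP[_ /allP n] _]; apply: n.
    by rewrite mem_rcons inE eqxx.
  have Er r : ~~ (r != [::]) -> induced E (a :: rcons r b) -> E a b.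
    by rewrite negbK => /eqP-> /= /andP[/andP[]].
  case: (boolP (p1 != [::])) => hp; case: (boolP (q1 != [::])) => hq.
  - by split=> //; apply: nE i1.
  - by case/negP: (nE _ hp i1); apply: Er i2.
  - by case/negP: (nE _ hq i2); apply: Er i1.
  by case: ne => h; rewrite h in hp hq.
(* Nothing precedes [a] or follows [b]: the paths meet only at their ends. *)
have [W0|W0] := eqVneq (s ++ p2) [::].
  left=> z; case: s p2 W0 e1 e2 {ip iq} => [|//] [|//] _ /=.
  move=> [_]; rewrite cats1 => /rcons_inj [_ yb] [_ e2].
  have {e2} eq : q = q1.
    case/lastP: q2 e2 => [|q2 y'] e2; first by move: e2; rewrite cats1 => /rcons_inj[].
    move: uq; rewrite cons_uniq e2 -rcons_cons -rcons_cat rcons_uniq.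
    move/(congr1 (last x)): e2; rewrite last_rcons -rcons_cons -rcons_cat last_rcons => <-.
    by rewrite mem_cat inE yb eqxx orbT andbF.
  rewrite eq => zp; apply: contraL zp => /d; rewrite inE negb_or mem_rcons inE.
  rewrite negb_or. by case/and3P.
have dis (r1 r2 : seq V) z : uniq (r1 ++ r2) -> z \in r1 -> z \notin r2.
  by rewrite cat_uniq => /and3P[_ /hasPn h _] z1; apply/negP=> /h; rewrite z1.
have up' := up; rewrite e1 in up'.
have ds z := dis _ _ z up'.
have [na ur] : a \notin p1 ++ b :: p2 /\ uniq (p1 ++ b :: p2).
  by move: up'; rewrite cat_uniq cons_uniq => /and3P[_ _ /andP[]].
have dp1 z := dis _ _ z ur.
have nb : b \notin p2.
  by move: ur; rewrite cat_uniq cons_uniq => /and3P[_ _ /andP[]].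
have tP z : z \in t -> z \notin s ++ a :: p1 ++ b :: p2.
  move=> zt; rewrite -e1 inE mem_rcons inE !negb_or.
  have [-> _] := dt _ zt; rewrite andbT.
  move: ut; rewrite cons_uniq rcons_uniq mem_rcons inE negb_or => /and3P[/andP[_ xt] yt _].
  by apply/andP; split; apply: contraTneq zt => ->.
have tq1 z : z \in t -> z \notin q1.
  move=> zt; have [_ nq] := dt _ zt; apply/negP=> zq1.
  have : z \in x :: rcons q y by rewrite e2 mem_cat inE mem_cat zq1 !orbT.
  have := tP _ zt; rewrite -e1 !inE !mem_rcons !inE (negbTE nq) !negb_or.
  by case/and3P=> /negbTE-> /negbTE->.
have q1P z : z \in q1 -> z \notin s ++ a :: p1 ++ b :: p2 by rewrite -e1; apply: d.
have inP z : (z \in s ++ a :: p1 ++ b :: p2) =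
   [|| z \in s, z == a, z \in p1, z == b | z \in p2].
  by rewrite mem_cat inE mem_cat inE.
have ab : a != b by apply: contraNneq na => ->; rewrite mem_cat inE eqxx orbT.
have sP : sorted E' (x :: rcons p y).
  exact: (@sub_sorted _ E) (induced_sorted ip).
have sQ : sorted E' (x :: rcons q y).
  exact: (@sub_sorted _ E) (induced_sorted iq).
have infix r1 r2 r3 : sorted E' (r1 ++ a :: r2 ++ b :: r3) -> sorted E' (a :: rcons r2 b).
  by case/cat_sorted2=> _; rewrite -cat_rcons -cat_cons => /cat_sorted2[].
have [S thS] : exists S, theta E' a b S.
  apply: (@theta_of_paths _ _ _ p1 q1 (rev s ++ t ++ rev p2)) => //.
    move=> r; rewrite !inE => /or3P[] /eqP->.
    - split=> //; first by apply: (infix s _ p2); rewrite -e1.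
        by apply: contra na; rewrite mem_cat => ->.
      by apply/negP=> /dp1; rewrite inE eqxx.
    - split=> //; first by apply: (infix s _ q2); rewrite -e2.
        by apply/negP=> /q1P; rewrite inP eqxx ?orbT.
      by apply/negP=> /q1P; rewrite inP eqxx ?orbT.
    split.
    - apply: contra W0; rewrite -!size_eq0 !size_cat !size_rev !addn_eq0.
      by case/and3P=> -> _ ->.
    - have [s1 es] : exists s1, rcons s a = x :: s1.
        by case: (s) e1 => [|x' s1] /= [-> _]; [exists [::] | exists (rcons s1 a)].
      have [p3 ep] : exists p3, b :: p2 = rcons p3 y.
        exists (belast b p2); rewrite lastI; congr rcons.
        move/(congr1 (last x)): e1.
        by rewrite last_cat last_cons last_rcons last_cons last_cat last_cons => ->.
      have srt r' : sorted E' r' -> sorted E' (rev r').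
        by rewrite rev_sorted; apply: sub_sorted => u v; rewrite symE'.
      have h1 : sorted E' (rcons (rev s1) x).
        rewrite -rev_cons -es; apply: srt; move: sP; rewrite e1 -cat_rcons.
        by case/cat_sorted2.
      have h3 : sorted E' (y :: rev p3).
        rewrite -rev_rcons -ep; apply: srt; move: sP; rewrite e1 => /cat_sorted2[_].
        by rewrite -cat_cons => /cat_sorted2[].
      have := sorted_join h1 st h3.
      have -> : rcons (rev s1) x = a :: rev s by rewrite -rev_cons -es rev_rcons.
      have -> : y :: rev p3 = rcons (rev p2) b by rewrite -rev_rcons -ep rev_cons.
      by rewrite !rcons_cat.
    - rewrite !mem_cat !mem_rev !negb_or; apply/and3P; split.
      + by apply/negP=> /ds; rewrite inE eqxx.
      + by apply/negP=> /tP; rewrite inP eqxx ?orbT.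
      by apply: contra na; rewrite mem_cat inE => ->; rewrite !orbT.
    rewrite !mem_cat !mem_rev !negb_or; apply/and3P; split=> //.
      by apply/negP=> /ds; rewrite inE mem_cat inE eqxx !orbT.
    by apply/negP=> /tP; rewrite inP eqxx ?orbT.
  move=> z; apply/and3P; split; apply/negP=> /andP[h1].
  - by move=> /q1P; rewrite inP h1 !orbT.
  - rewrite !mem_cat !mem_rev => /or3P[/ds|/tP|h2].
    + by rewrite inE mem_cat h1 orbT.
    + by rewrite inP h1 !orbT.
    by have := dp1 _ h1; rewrite inE h2 orbT.
  rewrite !mem_cat !mem_rev; have := q1P _ h1; rewrite inP !negb_or.
  case/and5P=> /negbTE-> _ _ _ /negbTE->; rewrite orbF /= => /tq1.
  by rewrite h1.
right; exists a, b, p1, S; split=> //.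
  move: up'; rewrite /induced_path i1 andbT -(cat_rcons b) -(cat_cons a) !cat_uniq.
  by case/and3P=> _ _ /andP[].
move/(congr1 size): e1; rewrite /= size_rcons size_cat /= size_cat /=.
move: W0; rewrite -size_eq0 size_cat.
move: (size s) (size p2) (size p1) (size p); clear; lia.
Qed.
End Colouring.

(** * Extending the coloured supergraph *)

Section Extension.
Variable V : eqType.
Implicit Types (E F : rel V) (s p q t vs : seq V) (a b u v x y z : V).
Implicit Type col : V -> V -> bool.

Lemma colour_or_bad E col x y :
  (exists c, forall p, induced_path E x p y ->
     ~~ (3 %| path_weight col (x :: rcons p y) + weight c)) \/
  exists p q, [/\ induced_path E x p y, induced_path E x q y,
    3 %| path_weight col (x :: rcons p y) + 1
    & 3 %| path_weight col (x :: rcons q y) + 2].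
Proof.
case: (classic (exists p, induced_path E x p y /\
    3 %| path_weight col (x :: rcons p y) + 1)) => [[p [ip dp]]|np]; last first.
  by left; exists true => p ip; apply/negP=> d; apply: np; exists p.
case: (classic (exists q, induced_path E x q y /\
    3 %| path_weight col (x :: rcons q y) + 2)) => [[q [iq dq]]|nq]; last first.
  by left; exists false => q iq; apply/negP=> d; apply: nq; exists q.
by right; exists p, q.
Qed.

Lemma induced_path_neq0 E x p y : ~~ E x y -> induced_path E x p y -> p != [::].
Proof. by case: p => // nE /andP[_ /= /andP[/andP[]]]; rewrite (negbTE nE). Qed.

Lemma induced_path_sorted E x p y : induced_path E x p y -> sorted E (x :: rcons p y).
Proof. by case/andP=> _ /induced_sorted. Qed.

Lemma induced_path_avoids E x p y z : induced_path E x p y -> z \in p -> (z != x) && (z != y).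
Proof.
case/andP; rewrite cons_uniq rcons_uniq mem_rcons inE negb_or.
case/and3P=> /andP[_ xp] yp _ _ zp.
by apply/andP; split; apply: contraTneq zp => ->.
Qed.

Lemma mod3_opposite A B : 3 %| A + 1 -> 3 %| B + 2 -> 3 %| A + B.
Proof. lia. Qed.

Lemma mod3_forced A B R : 3 %| A + 1 -> 3 %| B + 2 ->
  ~~ (3 %| R + A) -> ~~ (3 %| R + B) -> 3 %| R.
Proof. lia. Qed.

(** Suppose that [p] forbids one colour and [q] the other, so that their weights
sum to 0.  Their interiors touch, for otherwise they form an induced cycle.
Hence the union of the interiors is connected and, by [theta_K4_minor], touches
at most one of the three sets.  Induced paths through the other two sets form
induced cycles with both [p] and [q], so their weights are 0; but they also
form an induced cycle together. *)
Lemma theta_colour E col a b (S : 'I_3 -> pred V) : symmetric E ->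
  (forall u v, col u v = col v u) -> good E col -> ~ has_K4_minor E ->
  theta E a b S -> ~~ E a b ->
  exists c, forall p, induced_path E a p b ->
    ~~ (3 %| path_weight col (a :: rcons p b) + weight c).
Proof.
move=> symE symc gE nK thS nE; have [ab cS dS aS tS] := thS.
case: (colour_or_bad E col a b) => // -[p [q [ip iq dp dq]]].
have two r r' : induced_path E a r b -> induced_path E a r' b ->
    (forall u v, u \in r -> v \in r' -> (u != v) && ~~ E u v) ->
    ~~ (3 %| path_weight col (a :: rcons r b) + path_weight col (a :: rcons r' b)).
  exact: good_two_paths.
have p0 := induced_path_neq0 nE ip; have q0 := induced_path_neq0 nE iq.
pose D : pred V := predU (mem p) (mem q).
have avD z : D z -> (z != a) && (z != b).
  by case/orP=> [/(induced_path_avoids ip)|/(induced_path_avoids iq)].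
have cD : conn E D.
  apply: connU => //.
  - by have [] := path_interior symE (induced_path_sorted ip) p0.
  - by have [] := path_interior symE (induced_path_sorted iq) q0.
  apply: NNPP => no; have := two _ _ ip iq; rewrite mod3_opposite // => h.
  suff : false by []; apply: h => u v up vq; rewrite -negb_or; apply/negP=> uv.
  by apply: no; exists u, v; split=> //; case/orP: uv => [/eqP|]; [left | right].
pose touched i := exists u v, [/\ S i u, D v & u = v \/ E u v].
have touched_uniq i j : touched i -> touched j -> i = j.
  move=> [u [v [Su Dv uv]]] [u' [v' [Su' Dv' uv']]].
  apply: NNPP => /eqP ij; apply: nK; rewrite eq_sym in ij.
  apply: (theta_K4_minor symE thS Su Su' ij).
  have r1 w w' k : S k w -> D w' -> w = w' \/ E w w' ->
      reach E (fun z => (z != a) && (z != b)) w w'.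
    move=> Sw Dw' [<-|Eww']; first by apply: reach_refl; apply: (aS _ _ Sw).
    by apply: reach_edge => //; [apply: aS Sw | apply: avD].
  apply: reach_trans (r1 _ _ _ Su Dv uv) _.
  apply: (@reach_trans _ _ _ _ v').
    by apply: reach_sub (cD _ _ Dv Dv').
  by apply: reach_sym => //; apply: r1 Su' Dv' uv'.
have [i0 hi0] : exists i0, forall i, i != i0 -> ~ touched i.
  case: (classic (exists i, touched i)) => [[i ti]|no].
    by exists i => j ji tj; rewrite (touched_uniq _ _ tj ti) eqxx in ji.
  by exists ord0 => j _ tj; apply: no; exists j.
have [k /andP[ki _]] := third_index i0 i0; have [l /andP[li lk]] := third_index i0 k.
have getR i : exists r, induced_path E a r b /\ all (S i) r.
  have [ta tb] := tS i; apply: conn_induced_path => //.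
  by apply/negP=> /aS; rewrite eqxx andbF.
have [rk [irk ark]] := getR k; have [rl [irl arl]] := getR l.
have zero i r : i != i0 -> induced_path E a r b -> all (S i) r ->
    3 %| path_weight col (a :: rcons r b).
  move=> ii ir /allP ar.
  have far s : induced_path E a s b -> (forall z, z \in s -> D z) ->
      ~~ (3 %| path_weight col (a :: rcons r b) + path_weight col (a :: rcons s b)).
    move=> is_ sD; apply: two => // u v ur vs; rewrite -negb_or; apply/negP=> uv.
    apply: (hi0 _ ii); exists u, v; split; [exact: ar | exact: sD |].
    by case/orP: uv => [/eqP|]; [left | right].
  apply: mod3_forced dp dq (far _ ip _) (far _ iq _) => z zs; rewrite /D /= zs ?orbT //.
have zk := zero k rk ki irk ark; have zl := zero l rl li irl arl.
have := two _ _ irk irl; rewrite dvdn_addr // zl => h.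
suff : false by []; apply: h => u v /(allP ark) Su /(allP arl) Sv.
apply/andP; split.
  by apply: contraTneq lk => uv; rewrite uv in Su; rewrite (dS _ _ _ Sv Su) eqxx.
apply/negP=> Euv; apply: nK; apply: (theta_K4_minor symE thS Su Sv lk).
by apply: reach_edge => //; [apply: aS Su | apply: aS Sv].
Qed.

Definition edge_union E F : rel V := fun u v => E u v || F u v.

(** The quantification over [F] covers all edges that are still to come. *)
Definition extends E E' : Prop := subrel E E' /\
  forall F, symmetric F -> has_K4_minor (edge_union E' F) -> has_K4_minor (edge_union E F).

Lemma extends_trans E1 E2 E3 : extends E1 E2 -> extends E2 E3 -> extends E1 E3.
Proof.
move=> [s1 k1] [s2 k2]; split=> [u v /s1/s2//|F symF /(k2 _ symF)].
exact: k1.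
Qed.

Lemma eq_extends E E' : E =2 E' -> extends E E'.
Proof.
move=> eE; split=> [u v|F symF]; first by rewrite eE.
by apply: K4_minor_sub => u v; rewrite /edge_union eE.
Qed.

(** The new edge is absorbed into the future edges [F]. *)
Lemma extends_add_edge E E' x y :
  extends E E' -> extends (add_edge E x y) (add_edge E' x y).
Proof.
move=> [sE kE]; split=> [u v /orP[/sE|]|F symF k].
- by rewrite /add_edge => ->.
- by rewrite /add_edge => ->; rewrite orbT.
have symF' : symmetric (edge_union (same_pair x y) F).
  by move=> u v; rewrite /edge_union same_pairC symF.
have : has_K4_minor (edge_union E (edge_union (same_pair x y) F)).
  by apply: (kE _ symF'); apply: K4_minor_sub k => u v; rewrite /edge_union /add_edge orbA.
by apply: K4_minor_sub => u v; rewrite /edge_union /add_edge orbA.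
Qed.

Lemma extends_K4_minor E E' : extends E E' -> has_K4_minor E' -> has_K4_minor E.
Proof.
move=> [_ kE] k.
have : has_K4_minor (edge_union E (fun _ _ => false)).
  by apply: kE => //; apply: K4_minor_sub k => u v Euv; rewrite /edge_union Euv.
by apply: K4_minor_sub => u v; rewrite /edge_union orbF.
Qed.

Lemma theta_sub E E' a b (S : 'I_3 -> pred V) :
  subrel E E' -> theta E a b S -> theta E' a b S.
Proof.
move=> sE [ab cS dS aS tS]; split=> //.
  by move=> i x y Sx Sy; apply: reach_sub (cS i x y Sx Sy) => // u v _ _ /sE.
by move=> i; have [[u [v [h1 h2 /sE h3]]] [u' [v' [h1' h2' /sE h3']]]] := tS i;
  split; [exists u, v | exists u', v'].
Qed.

Lemma theta_extends E a b (S : 'I_3 -> pred V) : symmetric E -> theta E a b S ->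
  extends E (add_edge E a b).
Proof.
move=> symE th; split=> [u v Euv|F symF k]; first by rewrite /add_edge Euv.
have symU : symmetric (edge_union E F) by move=> u v; rewrite /edge_union symE symF.
apply: (@theta_add_edge _ _ a b S symU).
  by apply: theta_sub th => u v Euv; rewrite /edge_union Euv.
by apply: K4_minor_sub k => u v; rewrite /edge_union /add_edge orbAC.
Qed.

(** The list [vs] bounds the vertices in use, so that the nonadjacent pairs can be
counted. *)
Definition admissible vs E col : Prop :=
  [/\ symmetric E, irreflexive E, forall u v, col u v = col v u, good E col
    & forall u v, E u v -> u \in vs].

Definition nonedges vs E : nat :=
  count (fun e => ~~ E e.1 e.2) (allpairs pair vs vs).

Lemma count_ltn (T : eqType) (P Q : pred T) (l : seq T) (z : T) :
  subpred P Q -> z \in l -> Q z -> ~~ P z -> count P l < count Q l.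
Proof.
move=> sPQ; elim: l => //= h l IH; rewrite inE => /orP[/eqP<-|zl] Qz nPz.
  by rewrite Qz (negbTE nPz) add0n add1n ltnS; apply: sub_count.
have := IH zl Qz nPz; have := sPQ h.
by case: (P h) => [->//|_]; case: (Q h) => //= /ltnW.
Qed.

Lemma nonedges_ltn vs E E' a b : subrel E E' -> a \in vs -> b \in vs ->
  ~~ E a b -> E' a b -> nonedges vs E' < nonedges vs E.
Proof.
move=> sE av bv nE E'ab; apply: (@count_ltn _ _ _ _ (a, b)) => //=.
- by move=> [u v] /=; apply: contra => /sE.
- by apply/allpairsP; exists (a, b).
by rewrite E'ab.
Qed.

Lemma admissible_add vs E col x y c : admissible vs E col ->
  x \in vs -> y \in vs -> x != y -> ~~ E x y ->
  (forall p, induced_path E x p y ->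
     ~~ (3 %| path_weight col (x :: rcons p y) + weight c)) ->
  admissible vs (add_edge E x y) (add_colour col x y c) /\
  forall u v, E u v -> add_colour col x y c u v = col u v.
Proof.
move=> [symE irrE symc gE vE] xv yv xy nE hc; split.
  split.
  - exact: add_edge_sym.
  - move=> z; rewrite /add_edge irrE /same_pair /=.
    by case: (eqVneq z x) => [->|]; rewrite /= ?andbF // (negbTE xy).
  - by move=> u v; rewrite /add_colour same_pairC symc.
  - exact: good_add_edge.
  by move=> u v /orP[/vE//|/orP[] /andP[/eqP-> _]].
move=> u v Euv; rewrite /add_colour; case h: (same_pair x y u v) => //.
case/orP: h => /andP[/eqP eu /eqP ev]; move: nE; rewrite eu ev in Euv.
  by rewrite Euv.
by rewrite symE Euv.
Qed.

Lemma theta_mem vs E col a b (S : 'I_3 -> pred V) :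
  (forall u v, E u v -> u \in vs) -> theta E a b S -> a \in vs /\ b \in vs.
Proof.
move=> vE [_ _ _ _ /(_ ord0) [[u [v [/eqP-> _ /vE h]]] [u' [v' [/eqP-> _ /vE h']]]]].
by split.
Qed.

(** Outer induction on the number of nonadjacent pairs, inner induction on the
length of an induced path [p] from [x] to [y]. *)
Lemma extension vs E col x y : admissible vs E col ->
  x \in vs -> y \in vs -> x != y -> ~ has_K4_minor (add_edge E x y) ->
  exists E' col', [/\ admissible vs E' col',
    forall u v, E u v -> col' u v = col u v & extends (add_edge E x y) E'].
Proof.
have [m] := ubnP (nonedges vs E).
elim: m E col x y => // m IHm E col x y ltm adm.
have [symE irrE symc gE vE] := adm.
(* A preliminary edge [a b] decreases the number of nonadjacent pairs, so the
   outer induction hypothesis takes over. *)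
have after_edge a b E1 col1 x' y' : a \in vs -> b \in vs -> ~~ E a b ->
    admissible vs E1 col1 -> subrel E E1 -> E1 a b ->
    (forall u v, E u v -> col1 u v = col u v) ->
    extends (add_edge E x' y') (add_edge E1 x' y') ->
    x' \in vs -> y' \in vs -> x' != y' -> ~ has_K4_minor (add_edge E x' y') ->
    exists E' col', [/\ admissible vs E' col',
      forall u v, E u v -> col' u v = col u v & extends (add_edge E x' y') E'].
  move=> av bv nE adm1 sE E1ab col1E ex1 xv yv xy nK.
  have [||//|//|//||E2 [col2 [adm2 col2E ex2]]] := IHm E1 col1 x' y'.
  - by rewrite -ltnS; apply: leq_trans ltm; rewrite ltnS; apply: nonedges_ltn nE E1ab.
  - exact: adm1.
  - by move/(extends_K4_minor ex1).
  exists E2, col2; split=> //; last exact: extends_trans ex1 ex2.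
  by move=> u v Euv; rewrite col2E ?sE // col1E.
case Exy: (E x y).
  move=> xv yv xy nK; exists E, col; split=> //.
  have e : add_edge E x y =2 E.
    move=> u v; rewrite /add_edge; case h: (same_pair x y u v); last by rewrite orbF.
    by rewrite orbT; case/orP: h => /andP[/eqP-> /eqP->] //; rewrite symE.
  exact: eq_extends.
case: (colour_or_bad E col x y) => [[c hc]|[p [_ [ip _ _ _]]]].
  move=> xv yv xy nK; have nExy := negbT Exy.
  have [adm1 colE] := admissible_add adm xv yv xy nExy hc.
  by exists (add_edge E x y), (add_colour col x y c); split=> //; apply: eq_extends.
move/negbT: Exy => nExy.
have [n] := ubnP (size p).
elim: n p x y ip nExy => // n IHn p x y ip nExy ltn xv yv xy nK.
case: (colour_or_bad E col x y) => [[c hc]|[q1 [q2 [iq1 iq2 d1 d2]]]].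
  have [adm1 colE] := admissible_add adm xv yv xy nExy hc.
  by exists (add_edge E x y), (add_colour col x y c); split=> //; apply: eq_extends.
have symXY : symmetric (add_edge E x y) by apply: add_edge_sym.
have sXY : subrel E (add_edge E x y) by move=> u v Euv; rewrite /add_edge Euv.
have nKE : ~ has_K4_minor E by move=> k; apply: nK; apply: K4_minor_sub k.
have vXY u v : add_edge E x y u v -> u \in vs.
  by case/orP=> [/vE//|/orP[] /andP[/eqP-> _]].
(* Nonadjacent poles of a theta of [E] are joined before anything else. *)
case: (classic (exists a b (S : 'I_3 -> pred V), theta E a b S /\ ~~ E a b)).
  move=> [a [b [S [th nEab]]]].
  have [av bv] := theta_mem col vE th; have [ab _ _ _ _] := th.
  have [c hc] := theta_colour symE symc gE nKE th nEab.
  have [adm1 colE] := admissible_add adm av bv ab nEab hc.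
  apply: (after_edge a b _ _ x y av bv nEab adm1) => //.
  - by move=> u v Euv; rewrite /add_edge Euv.
  - by rewrite /add_edge /same_pair !eqxx orbT.
  exact/extends_add_edge/(theta_extends symE th).
move=> no_theta.
apply: NNPP => no_ext.
have Exy : add_edge E x y x y by rewrite /add_edge /same_pair !eqxx orbT.
(* If [q] meets the interior of [p], the theta closed by the edge [x y] has its
   poles on [p], closer together than [x] and [y], so they are joined first. *)
have disj q : induced_path E x q y -> p != q -> forall z, z \in p -> z \notin q.
  move=> iq pq.
  have [|||//|[a [b [p1 [S [ip1 nEab lt1 th]]]]]] :=
    detour symXY sXY ip iq pq (t := [::]).
  - by rewrite /= Exy.
  - by rewrite /= inE xy.
  - by [].
  case: no_ext.
  have [av bv] := theta_mem col vXY th; have [ab _ _ _ _] := th.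
  have exAB := theta_extends symXY th.
  have eAB : add_edge (add_edge E x y) a b =2 add_edge (add_edge E a b) x y.
    by move=> u v; rewrite /add_edge orbAC.
  have nKab : ~ has_K4_minor (add_edge E a b).
    move=> k; apply: nK; apply: (theta_add_edge symXY th).
    by apply: K4_minor_sub k => u v; rewrite eAB /add_edge => ->.
  have [|E1 [col1 [adm1 col1E ex1]]] :=
    IHn p1 a b ip1 nEab _ av bv ab nKab; first by rewrite -ltnS; apply: leq_trans ltn; rewrite ltnS.
  have sE1 : subrel (add_edge E a b) E1 by case: ex1.
  apply: (after_edge a b _ _ x y av bv nEab adm1) => //.
  - by move=> u v Euv; apply: sE1; rewrite /add_edge Euv.
  - by apply: sE1; rewrite /add_edge /same_pair !eqxx orbT.
  apply: extends_trans exAB _; apply: extends_trans (eq_extends eAB) _.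
  exact: extends_add_edge.
have sortXY r : induced_path E x r y -> sorted (add_edge E x y) (x :: rcons r y).
  by move/induced_path_sorted; apply: sub_sorted.
have two q q' : induced_path E x q y -> induced_path E x q' y ->
    (forall z, z \in q -> z \notin q') ->
    ~~ (3 %| path_weight col (x :: rcons q y) + path_weight col (x :: rcons q' y)).
  move=> iq iq' dqq; apply: (good_two_paths symE symc gE nExy iq iq').
  move=> u v uq vq'; apply/andP; split.
    by apply: contraTneq (dqq _ uq) => ->; rewrite vq'.
  apply/negP=> Euv; apply: nK.
  apply: (@chord_K4_minor _ _ x y q q') => //.
  - exact: induced_path_neq0 iq.
  - exact: sortXY.
  - by case/andP: iq.
  - exact: induced_path_neq0 iq'.
  - exact: sortXY.
  - by case/andP: iq'.
  by exists u, v; split=> //; apply: sXY.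
have [e1|n1] := eqVneq p q1.
  have [e2|n2] := eqVneq p q2.
    move: d1 d2; rewrite -e1 -e2; move: (path_weight _ _); clear; lia.
  have := two _ _ ip iq2 (disj _ iq2 n2); rewrite {1}e1.
  by rewrite mod3_opposite.
have [e2|n2] := eqVneq p q2.
  have := two _ _ ip iq1 (disj _ iq1 n1); rewrite {1}e2 addnC.
  by rewrite mod3_opposite.
(* Now [q1] and [q2] are both disjoint from [p], so if they met each other, [p]
   would close a theta inside [E]. *)
have n12 : q1 != q2.
  apply/negP=> /eqP e; move: d1 d2; rewrite e; move: (path_weight _ _); clear; lia.
have [|d12|[a [b [p1 [S [_ nEab _ th]]]]]] :=
  detour symE (fun u v Euv => Euv) iq1 iq2 n12 (induced_path_sorted ip) (proj1 (andP ip)).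
- by move=> z zp; split; [apply: (disj _ iq1 n1) | apply: (disj _ iq2 n2)].
- by have := two _ _ iq1 iq2 d12; rewrite mod3_opposite.
by apply: no_theta; exists a, b, S.
Qed.
End Extension.

(** * The game *)

(** The invariant of Painter's strategy: the board with its colours lies in an
admissible supergraph that is as permissive as the board. *)
Definition has_plan (s : position) : Prop := exists (vs : seq nat) E col,
  [/\ admissible vs E col,
      forall e c, (e, c) \in s -> e.1 != e.2 -> E e.1 e.2 /\ col e.1 e.2 = c
    & extends (edge_rel [seq m.1 | m <- s]) E].

Lemma has_plan_nil : has_plan [::].
Proof.
exists [::], (fun _ _ => false), (fun _ _ => true); split=> //.
by apply: eq_extends => u v; rewrite /edge_rel andbF.
Qed.

Lemma edge_rel_cons e l : e.1 != e.2 ->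
  edge_rel (e :: l) =2 add_edge (edge_rel l) e.1 e.2.
Proof.
case: e => x y /= xy u v; rewrite /edge_rel /add_edge /same_pair !inE !xpair_eqE.
have [->|uv] := eqVneq u v.
  by rewrite /=; apply/esym/negbTE/negP=> /orP[] /andP[/eqP e1 /eqP e2];
    rewrite -e1 -e2 eqxx in xy.
rewrite /= [(v == x) && _]andbC.
by do ![case: (_ == _) | case: (_ \in _)].
Qed.

Lemma has_plan_step s e : has_plan s -> legal K4_minor_free s e ->
  exists c, has_plan ((e, c) :: s).
Proof.
move=> [vs [E [col [adm colE ex]]]] [xy nE mf].
have eE := edge_rel_cons [seq m.1 | m <- s] xy.
have ex1 : extends (edge_rel (e :: [seq m.1 | m <- s])) (add_edge E e.1 e.2).
  exact: extends_trans (eq_extends eE) (extends_add_edge _ _ ex).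
have nK : ~ has_K4_minor (add_edge E e.1 e.2).
  by move/(extends_K4_minor ex1) => [B hB]; apply: mf; exists B.
have adm' : admissible [:: e.1, e.2 & vs] E col.
  have [h1 h2 h3 h4 h5] := adm; split=> // u v /h5 uv.
  by rewrite !inE uv !orbT.
have [||E' [col' [adm2 col2 ex2]]] := extension adm' _ _ xy nK.
- by rewrite inE eqxx.
- by rewrite !inE eqxx orbT.
exists (col' e.1 e.2), [:: e.1, e.2 & vs], E', col'; split=> //; last first.
  exact: extends_trans ex1 ex2.
have [sE _] := ex2.
move=> e' c'; rewrite inE => /orP[/eqP[-> ->]|h] xy'.
  by split=> //; apply: sE; rewrite /add_edge /same_pair !eqxx orbT.
have [Ee' ce'] := colE _ _ h xy'.
by split; [apply: sE; rewrite /add_edge Ee' | rewrite col2].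
Qed.

Lemma has_plan_no_mono s : has_plan s -> ~ mono_copy C3 s.
Proof.
move=> [vs [E [col [[symE irrE symc gE _] colE _]]]] [c [f [injf adjf]]].
have edge i j : i != j -> E (f i) (f j) /\ col (f i) (f j) = c.
  move=> ij; have /andP[fij] := adjf i j ij.
  case/orP=> /mapP[[e c']]; rewrite mem_filter => /andP[/= /eqP-> es] ee;
    have := colE _ _ es; rewrite -ee /=.
    exact.
  by rewrite symE symc eq_sym; apply.
have [E01 c01] := edge (@Ordinal 3 0 isT) (@Ordinal 3 1 isT) isT.
have [E12 c12] := edge (@Ordinal 3 1 isT) (@Ordinal 3 2 isT) isT.
have [E02 c02] := edge (@Ordinal 3 0 isT) (@Ordinal 3 2 isT) isT.
move: E01 c01 E12 c12 E02 c02.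
set u := f _; set v := f _; set w := f _.
move=> Euv cuv Evw cvw Euw cuw.
have ne x y : E x y -> x != y by apply: contraTneq => ->; rewrite irrE.
have [uv vw uw] := And3 (ne _ _ Euv) (ne _ _ Evw) (ne _ _ Euw).
have := gE u [:: v] w isT Euw.
rewrite /= cuv cvw cuw => h; suff /h : induced_path (del_edge E u w) u [:: v] w.
  by case: (c).
rewrite /induced_path /= /del_edge /same_pair !inE !negb_or uv vw uw Euv Evw Euw !eqxx.
by rewrite [v == u]eq_sym (negbTE uv) (negbTE vw) (negbTE uw) /= ?andbF.
Qed.

Theorem theorem2p4 : painter_wins C3 K4_minor_free.
Proof.
pose sigma s e := epsilon (inhabits true) (fun c => has_plan ((e, c) :: s)).
exists sigma => s rs; apply: has_plan_no_mono.
elim: rs => [|{}s e _ ps le]; first exact: has_plan_nil.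
by apply: (epsilon_spec (inhabits true) (fun c => has_plan ((e, c) :: s))); apply: has_plan_step.
Qed.
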